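(* Let $S$ be a commutative Noetherian ring of finite dimension $d\ge3$ such that there exists a subset $U=\{u_1,\dots,u_d\}$ of $S$ for which the ideal $(U)$ has height $d$ and suppose that each ideal generated by a subset of $U$ is a prime ideal of $S$. Let $X,Y,Z$ be disjoint non-empty subsets of $U$ such that $|X|\le|Y|\le|Z|$, and let $X'$ and $Y'$ be non-empty subsets of $X$ and $Y$ respectively. Set $J:=(X)\cap(Y)\cap(Z)$, $R:=S/J$ and $I:=((X')+(Y')+J)/J$. Then: (i) $\operatorname{Ass}_R(R)=\{\mathfrak p_1:=(X)/J,\ \mathfrak p_2:=(Y)/J,\ \mathfrak p_3:=(Z)/J\}$. (ii) $\operatorname{depth}_R(I,R/\mathfrak p_1)=\operatorname{cd}_R(I,R/\mathfrak p_1)=|Y'|$, $\operatorname{depth}_R(I,R/\mathfrak p_2)=\operatorname{cd}_R(I,R/\mathfrak p_2)=|X'|$ and $\operatorname{depth}_R(I,R/\mathfrak p_3)=\operatorname{cd}_R(I,R/\mathfrak p_3)=|X'|+|Y'|$. (iii) $\dim_R(R/\mathfrak p_1)=d-|X|$, $\dim_R(R/\mathfrak p_2)=d-|Y|$ and $\dim_R(R/\mathfrak p_3)=d-|Z|$. (iv) $\Gamma_I(R)=0$, $\dim_R(R)=\dim_R(R/\Gamma_I(R))=d-|X|$ and $c:=\operatorname{cd}_R(I,R)=|X'|+|Y'|$. (v) Set $\mathfrak q:=(U\setminus(X'\cup Y'))/J$. Then $\mathfrak p_3\subseteq\mathfrak q$ and $\operatorname{cd}_R(I,R/\mathfrak q)=\dim_R(R/\mathfrak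 q)=c$. (vi) $\operatorname{Ann}_R(H^c_I(R))=(Z)/J$ and $\dim_R(R/\operatorname{Ann}_R(H^c_I(R)))=d-|Z|$. In particular, $$\dim_R(R/\Gamma_I(R))-\dim_R(R/\operatorname{Ann}_R(H^c_I(R)))=|Z|-|X|.$$
   Context: $(V)$ denotes the ideal of $S$ generated by a subset $V\subseteq S$, and $|A|$ the cardinality of a set $A$. $H^i_I(N)$ is the $i$-th local cohomology module of $N$ with respect to $I$ and $\Gamma_I(N)=\bigcup_{t}(0:_NI^t)$. $\operatorname{cd}_R(I,N)$ (respectively $\operatorname{depth}_R(I,N)$) is the supremum (respectively infimum) of the integers $i\ge0$ with $H^i_I(N)\ne0$. (Lynch's conjecture, to which this gives counterexamples when $|X|<|Z|$ in the local case, asserts $\dim_R(R/\operatorname{Ann}_R(H^c_I(R)))=\dim_R(R/\Gamma_I(R))$ for a local ring $R$ and a proper ideal $I$ with $c=\operatorname{cd}_R(I,R)>0$.) *)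

(* Defs.v *)
From HB Require Import structures.
From mathcomp Require Import all_boot all_order all_algebra.
From mathcomp Require Import generic_quotient ring_quotient finmap.
From mathcomp Require Import boolp classical_sets constructive_ereal.

Set Implicit Arguments.
Unset Strict Implicit.
Unset Printing Implicit Defensive.

Import Order.TTheory GRing.Theory Num.Theory.
Local Open Scope classical_set_scope.
Local Open Scope ring_scope.
Local Open Scope quotient_scope.

(* Suprema and infima are taken in the integers extended by -oo and +oo, with *)
(* sup(empty) = -oo and inf(empty) = +oo.                                     *)
Definition esup (A : set (\bar int)) : \bar int := supremum -oo%E A.
Definition einf (A : set (\bar int)) : \bar int := infimum +oo%E A.

Definition ebar (n : nat) : \bar int := (n%:Z)%:E.

(* Submodules and ideals are bundled Prop-valued sets: the library's          *)
(* predicates submodClosed and idealr are boolean, and the latter excludes    *)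
(* the unit ideal.                                                            *)
Identity Coercion set_to_fun : set >-> Funclass.

Record submodule (R : pzRingType) (M : lmodType R) := Submodule {
  submod_set :> set M;
  submod0 : submod_set 0;
  submodD : forall x y, submod_set x -> submod_set y -> submod_set (x + y);
  submodZ : forall a x, submod_set x -> submod_set (a *: x)
}.

Notation ideal R := (submodule R^o).

#[local] Obligation Tactic := idtac.

Section Submodules.
Variables (R : pzRingType) (M : lmodType R).
Implicit Types (N : submodule M) (A : set M).

Lemma submodP N1 N2 : (forall x, N1 x <-> N2 x) -> N1 = N2.
Proof.
case: N1 N2 => [A1 a1 b1 c1] [A2 a2 b2 c2] /= h.
have e : A1 = A2 by apply/seteqP; split=> x /h.
by rewrite e in a1 b1 c1 *; congr Submodule; apply: Prop_irrelevance.
Qed.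

Program Definition zero_submod : submodule M := @Submodule _ _ [set 0] _ _ _.
Next Obligation. by []. Qed.
Next Obligation. by move=> x y -> ->; rewrite /= addr0. Qed.
Next Obligation. by move=> a x ->; rewrite /= scaler0. Qed.

Program Definition span A : submodule M :=
  @Submodule _ _ [set x | forall N, A `<=` N -> N x] _ _ _.
Next Obligation. by move=> A N _; apply: submod0. Qed.
Next Obligation.
by move=> A x y Nx Ny N AN; apply: submodD; [apply: Nx|apply: Ny].
Qed.
Next Obligation. by move=> A a x Nx N AN; apply/submodZ/Nx. Qed.

Program Definition submod_cap N1 N2 : submodule M :=
  @Submodule _ _ (N1 `&` N2) _ _ _.
Next Obligation. by move=> N1 N2; split; apply: submod0. Qed.
Next Obligation. by move=> N1 N2 x y [? ?] [? ?]; split; apply: submodD. Qed.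
Next Obligation. by move=> N1 N2 a x [? ?]; split; apply: submodZ. Qed.

Program Definition submod_add N1 N2 : submodule M :=
  @Submodule _ _ [set x + y | x in N1 & y in N2] _ _ _.
Next Obligation.
by move=> N1 N2; exists 0; [apply: submod0|exists 0; [apply: submod0|rewrite addr0]].
Qed.
Next Obligation.
move=> N1 N2 _ _ [x ? [y ? <-]] [x' ? [y' ? <-]].
by exists (x + x'); [apply: submodD|exists (y + y'); [apply: submodD|rewrite addrACA]].
Qed.
Next Obligation.
move=> N1 N2 a _ [x ? [y ? <-]].
by exists (a *: x); [apply: submodZ|exists (a *: y); [apply: submodZ|rewrite scalerDr]].
Qed.

Definition submod_pred N : M -> bool := fun x => x \in (N : set M).

Lemma submod_predE N x : (x \in submod_pred N) = `[< N x >].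
Proof. by []. Qed.

Lemma submod_pred_closed N : submod_closed (submod_pred N).
Proof.
split; first by rewrite submod_predE; apply/asboolP/submod0.
move=> a x y; rewrite !submod_predE => /asboolP Nx /asboolP Ny.
by apply/asboolP/submodD => //; apply: submodZ.
Qed.

HB.instance Definition _ N :=
  GRing.isSubmodClosed.Build R M (submod_pred N) (submod_pred_closed N).

Definition submod_type N : Type := {x : M | submod_pred N x}.
HB.instance Definition _ N := [isSub of submod_type N for @sval _ _].
HB.instance Definition _ N := [Choice of submod_type N by <:].
HB.instance Definition _ N := [SubChoice_isSubLmodule of submod_type N by <:].

Definition quot_module N : Type :=
  Quotient.quot (GRing.ZmodClosed.clone M (submod_pred N) _).
HB.instance Definition _ N := GRing.Zmodule.on (quot_module N).
HB.instance Definition _ N := EqQuotient.on (quot_module N).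


Section QuotModule.
Variable N : submodule M.
Definition quot_pi (x : M) : quot_module N := \pi_(quot_module N) x.

Lemma quot_piE x y : quot_pi x = quot_pi y <-> N (x - y).
Proof.
split=> [/eqP|h]; first by rewrite -Quotient.idealrBE => /asboolP.
by apply/eqP; rewrite -Quotient.idealrBE; apply/asboolP.
Qed.

Lemma quot_pi_surj (z : quot_module N) : exists x, quot_pi x = z.
Proof. by exists (repr z); rewrite /quot_pi reprK. Qed.

Lemma quot_piD : {morph quot_pi : x y / x + y}.
Proof. by move=> x y; rewrite /quot_pi raddfD. Qed.

Definition quot_scale (a : R) (z : quot_module N) : quot_module N :=
  quot_pi (a *: repr z).

Lemma quot_piZ a x : quot_pi (a *: x) = quot_scale a (quot_pi x).
Proof.
apply/quot_piE; rewrite -scalerBr; apply/submodZ/quot_piE.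
by rewrite /quot_pi reprK.
Qed.

Fact quot_scaleA a b z : quot_scale a (quot_scale b z) = quot_scale (a * b) z.
Proof. by have [x <-] := quot_pi_surj z; rewrite -!quot_piZ scalerA. Qed.
Fact quot_scale1 : left_id 1 quot_scale.
Proof. by move=> z; have [x <-] := quot_pi_surj z; rewrite -quot_piZ scale1r. Qed.
Fact quot_scaleDr : right_distributive quot_scale +%R.
Proof.
move=> a z t; have [x <-] := quot_pi_surj z; have [y <-] := quot_pi_surj t.
by rewrite -quot_piD -!quot_piZ scalerDr quot_piD.
Qed.
Fact quot_scaleDl z : {morph quot_scale^~ z : a b / a + b}.
Proof.
move=> a b; have [x <-] := quot_pi_surj z.
by rewrite -!quot_piZ scalerDl quot_piD.
Qed.
HB.instance Definition _ := GRing.Zmodule_isLmodule.Build R (quot_module N)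
  quot_scaleA quot_scale1 quot_scaleDr quot_scaleDl.

Lemma quot_pi_linear : linear quot_pi.
Proof. by move=> a x y; rewrite quot_piD quot_piZ. Qed.
HB.instance Definition _ :=
  GRing.isLinear.Build R M (quot_module N) _ quot_pi quot_pi_linear.

End QuotModule.
End Submodules.

Section QuotientRing.
Variables (R : comPzRingType) (J : ideal R).

(* The quotient ring R / J; unlike {ideal_quot J} it allows J = R. *)
Definition quot_ring : Type := @quot_module R R^o J.
HB.instance Definition _ := GRing.Zmodule.on quot_ring.

Definition ring_pi (x : R) : quot_ring := @quot_pi R R^o J x.
Definition quot_one : quot_ring := ring_pi 1.
Definition quot_mul (z t : quot_ring) : quot_ring :=
  ring_pi ((repr (z : quot_module J) : R) * (repr (t : quot_module J) : R)).

Lemma ring_piE x y : ring_pi x = ring_pi y <-> J (x - y).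
Proof. exact: (@quot_piE R R^o J). Qed.

Lemma ring_pi_surj (z : quot_ring) : exists x, ring_pi x = z.
Proof. exact: (@quot_pi_surj R R^o J). Qed.

Lemma ring_piD : {morph ring_pi : x y / x + y}.
Proof. exact: (@quot_piD R R^o J). Qed.

Lemma ring_piM : {morph ring_pi : x y / x * y >-> quot_mul x y}.
Proof.
move=> x y; apply/ring_piE.
have hJ z : J (z - repr (ring_pi z : quot_module J)).
  by apply/quot_piE; rewrite /quot_pi reprK.
set x' : R := repr _; set y' : R := repr _.
have -> : x * y - x' * y' = y *: ((x - x') : R^o) + x' *: ((y - y') : R^o).
  by rewrite /GRing.scale /= mulrC !mulrBr (mulrC y x') addrA subrK.
by apply: submodD; apply: submodZ; apply: hJ.
Qed.

Fact quot_mulA : associative quot_mul.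
Proof.
move=> a b c; have [x <-] := ring_pi_surj a; have [y <-] := ring_pi_surj b.
by have [z <-] := ring_pi_surj c; rewrite -!ring_piM mulrA.
Qed.
Fact quot_mulC : commutative quot_mul.
Proof.
move=> a b; have [x <-] := ring_pi_surj a; have [y <-] := ring_pi_surj b.
by rewrite -!ring_piM mulrC.
Qed.
Fact quot_mul1 : left_id quot_one quot_mul.
Proof. by move=> a; have [x <-] := ring_pi_surj a; rewrite -ring_piM mul1r. Qed.
Fact quot_mulDl : left_distributive quot_mul +%R.
Proof.
move=> a b c; have [x <-] := ring_pi_surj a; have [y <-] := ring_pi_surj b.
have [z <-] := ring_pi_surj c.
by rewrite -ring_piD -!ring_piM mulrDl ring_piD.
Qed.
HB.instance Definition _ := GRing.Zmodule_isComPzRing.Build quot_ring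
  quot_mulA quot_mulC quot_mul1 quot_mulDl.

(* The ideal (A + J) / J of R / J, i.e. A / J when A contains J. *)
Program Definition quot_ideal (A : ideal R) : ideal quot_ring :=
  @Submodule _ _ [set ring_pi x | x in A] _ _ _.
Next Obligation.
by move=> A; exists 0; [apply: submod0|apply: (raddf0 (@quot_pi R R^o J))].
Qed.
Next Obligation.
move=> A _ _ [x Ax <-] [y Ay <-]; exists (x + y); last exact: ring_piD.
exact: (submodD Ax Ay).
Qed.
Next Obligation.
move=> A a _ [x Ax <-]; have [b <-] := ring_pi_surj a.
by exists (b * x); [apply: (submodZ b Ax)|rewrite ring_piM].
Qed.

End QuotientRing.

Section CommutativeAlgebra.
Variable R : comPzRingType.
Implicit Types (M : lmodType R) (I P Q : ideal R).

Definition ideal_gen (V : set R) : ideal R := @span R R^o V.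

Definition noetherian : Prop :=
  forall I, exists s : seq R, I = ideal_gen [set` s].

Definition prime_ideal P : Prop :=
  ~ P 1 /\ forall x y : R, P (x * y) -> P x \/ P y.

Program Definition ann_elt M (x : M) : ideal R :=
  @Submodule _ _ [set a : R^o | (a : R) *: x = 0] _ _ _.
Next Obligation. by move=> M x /=; rewrite scale0r. Qed.
Next Obligation. by move=> M x a b /= ax bx; rewrite scalerDl ax bx addr0. Qed.
Next Obligation. by move=> M x a b /= bx; rewrite -scalerA bx scaler0. Qed.

Program Definition ann M : ideal R :=
  @Submodule _ _ [set a : R^o | forall x : M, (a : R) *: x = 0] _ _ _.
Next Obligation. by move=> M x /=; rewrite scale0r. Qed.
Next Obligation. by move=> M a b /= ax bx x; rewrite scalerDl ax bx addr0. Qed.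
Next Obligation. by move=> M a b /= bx x; rewrite -scalerA bx scaler0. Qed.

Definition Ass M : set (ideal R) :=
  [set P | prime_ideal P /\ exists x : M, P = ann_elt x].

(* The localization of M at P is nonzero iff some x : M is killed by no       *)
(* element outside P.                                                         *)
Definition Supp M : set (ideal R) :=
  [set P | prime_ideal P /\ exists x : M, forall a : R, ~ P a -> a *: x <> 0].

(* The supremum of the lengths n of the chains P_0 < ... < P_n in C. *)
Definition chain_sup (C : set (ideal R)) : \bar int :=
  esup [set ebar n | n in [set n | exists P : nat -> ideal R,
    (forall i, (i <= n)%N -> C (P i)) /\
    (forall i, (i < n)%N -> P i `<` P i.+1)]].

Definition ring_dim : \bar int := chain_sup prime_ideal.

Definition mod_dim M : \bar int := chain_sup (Supp M).

Definition prime_height P : \bar int :=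
  chain_sup [set Q | prime_ideal Q /\ Q `<=` P].

Definition height I : \bar int :=
  einf [set prime_height P | P in [set P | prime_ideal P /\ I `<=` P]].

Definition ideal_mul I1 I2 : ideal R :=
  ideal_gen [set (a : R) * (b : R) | a in I1 & b in I2].

Definition unit_ideal : ideal R := ideal_gen [set 1].

Definition ideal_pow I (t : nat) : ideal R := iter t (ideal_mul I) unit_ideal.

Lemma unit_idealE (a : R) : unit_ideal a.
Proof.
by move=> N /(_ 1 erefl) /(submodZ a); rewrite /GRing.scale /= mulr1.
Qed.

Lemma ideal_pow_anti I m n : (m <= n)%N -> ideal_pow I n `<=` ideal_pow I m.
Proof.
move=> mn; rewrite -(subnK mn); elim: (n - m)%N => [|k IHk] //= a.
move=> /(_ (ideal_pow I m)); apply=> _ [x Ix [y Iy <-]].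
exact: (submodZ x (IHk _ Iy)).
Qed.

Program Definition Gamma I M : submodule M := @Submodule _ _
  [set x | exists t, forall a : R, ideal_pow I t a -> a *: x = 0] _ _ _.
Next Obligation. by move=> I M; exists 0%N => a _; rewrite scaler0. Qed.
Next Obligation.
move=> I M x y [s sx] [t ty]; exists (s + t)%N => a Ia; rewrite scalerDr.
by rewrite sx ?ty ?addr0 //; apply: ideal_pow_anti Ia; rewrite ?leq_addl ?leq_addr.
Qed.
Next Obligation.
by move=> I M b x [t tx]; exists t => a Ia; rewrite scalerA mulrC -scalerA tx ?scaler0.
Qed.

Definition injective_module M : Prop :=
  forall (A B : lmodType R) (f : {linear A -> B}) (g : {linear A -> M}),
    injective f -> exists h : {linear B -> M}, forall x, h (f x) = g x.

Record injective_resolution M := InjectiveResolution {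
  res_obj : nat -> lmodType R;
  res_aug : {linear M -> res_obj 0};
  res_diff : forall i, {linear res_obj i -> res_obj i.+1};
  res_injective : forall i, injective_module (res_obj i);
  res_aug_inj : injective res_aug;
  res_exact0 : forall x, res_diff 0 x = 0 <-> exists y, res_aug y = x;
  res_exact : forall i x, res_diff i.+1 x = 0 <-> exists y, res_diff i y = x
}.

End CommutativeAlgebra.

Section LocalCohomology.
Variables (R : comPzRingType) (I : ideal R).
Implicit Types (M N : lmodType R).

Program Definition submod_in M (N1 N2 : submodule M) :
    submodule (submod_type N1) :=
  @Submodule _ _ [set x | N2 (\val x)] _ _ _.
Next Obligation.
move=> M N1 N2; change (N2 (\val (0 : submod_type N1))).
by rewrite raddf0; apply: submod0.
Qed.
Next Obligation.
move=> M N1 N2 x y Nx Ny; change (N2 (\val (x + y))).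
by rewrite raddfD; apply: submodD.
Qed.
Next Obligation.
move=> M N1 N2 a x Nx; change (N2 (\val (a *: x))).
by rewrite linearZ; apply: submodZ.
Qed.

(* N1 / (N1 n N2), that is N1 / N2 when N2 is contained in N1. *)
Definition subquot M (N1 N2 : submodule M) : lmodType R :=
  quot_module (submod_in N1 N2).

Section OfResolution.
Variables (N : lmodType R) (E : injective_resolution N).

(* Cocycles and coboundaries of the complex Gamma_I(E_0) -> Gamma_I(E_1) -> .. *)
Program Definition cocycles i : submodule (res_obj E i) := @Submodule _ _
  [set x | Gamma I (res_obj E i) x /\ res_diff E i x = 0] _ _ _.
Next Obligation. by move=> i; split; [apply: submod0|rewrite raddf0]. Qed.
Next Obligation.
move=> i x y [Gx dx] [Gy dy]; split; first exact: submodD.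
by rewrite raddfD /= dx dy addr0.
Qed.
Next Obligation.
move=> i a x [Gx dx]; split; first exact: submodZ.
by rewrite linearZ /= dx scaler0.
Qed.

Program Definition boundaries i : submodule (res_obj E i.+1) := @Submodule _ _
  [set res_diff E i x | x in Gamma I (res_obj E i)] _ _ _.
Next Obligation. by move=> i; exists 0; [apply: submod0|rewrite raddf0]. Qed.
Next Obligation.
move=> i _ _ [x Gx <-] [y Gy <-].
by exists (x + y); [apply: submodD|rewrite raddfD].
Qed.
Next Obligation.
by move=> i a _ [x Gx <-]; exists (a *: x); [apply: submodZ|rewrite linearZ].
Qed.

Definition coboundaries i : submodule (res_obj E i) :=
  match i with 0 => zero_submod _ | j.+1 => boundaries j end.

Definition cohomology_of i : lmodType R :=
  subquot (cocycles i) (coboundaries i).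

End OfResolution.

(* H^i_I(N): the right derived functors of Gamma_I, computed from a chosen    *)
(* injective resolution of N. Every module has one, so the last branch, the   *)
(* zero module, is never taken.                                               *)
Definition local_cohomology (i : nat) N : lmodType R :=
  match pselect (exists E : injective_resolution N, True) with
  | left exE => cohomology_of (projT1 (cid exE)) i
  | right _ => subquot (zero_submod N) (zero_submod N)
  end.

Definition nonvanishing N : set nat :=
  [set i | exists x : local_cohomology i N, x <> 0].

Definition cd N : \bar int := esup [set ebar i | i in nonvanishing N].
Definition depth N : \bar int := einf [set ebar i | i in nonvanishing N].

End LocalCohomology.

(* Main.v *)
Require Import Defs.
From HB Require Import structures.
From mathcomp Require Import all_boot all_order all_algebra.
From mathcomp Require Import finmap ring zify.
From mathcomp Require Import boolp classical_sets functions constructive_ereal.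

(* A single injective resolution E of N computes everything. For an injective
   module the I-torsion part surjects onto its localization at any element (weak
   Artin-Rees and Baer's test), so adding a generator a to I relates the complexes
   Gamma_I(E) and Gamma_(I + a)(E). By induction H^i_I(N) vanishes above the number
   n of generators not annihilating N, and H^n_I(N) consists of fractions
   m / (a_1 ... a_n)^t, where m / a^t = 0 iff (a_1 ... a_n)^k m lies in
   (a_1^(t+k), ..., a_n^(t+k)) N for some k. When the a_i form a regular sequence in
   any order, the lower cohomology vanishes and the class of 1 is not zero.
   The fractions also give the annihilator of H^c_I(R): an element of (Z) kills it
   since x y z lies in J for x in X', y in Y', z in (Z), and conversely an element
   killing it lies in (Z) + (a_1^t, ..., a_c^t) for all t, hence in (Z) by Krull's
   intersection theorem. Krull's height theorem shows that no element of U lies in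
   the ideal generated by the others, whence the dimensions. *)

Set Implicit Arguments.
Unset Strict Implicit.
Unset Printing Implicit Defensive.

Import Order.TTheory GRing.Theory Num.Theory.
Local Open Scope classical_set_scope.
Local Open Scope ring_scope.

#[local] Obligation Tactic := idtac.


(** * Regular sequences and noetherian rings *)

(** [local_cohomology] picks its injective resolution by choice, so everything is proved for an
    arbitrary resolution E. Division by a generator a is possible in an injective module only up to
    a power of a, and classes are known only up to coboundaries; hence [fraction] is a relation, and
    most statements carry an exponent k to be found. The generators are split as s ++ s0, where s0
    annihilates N: on R / p1 the elements of X' act as zero, so only Y' counts, and symmetrically on
    R / p2. That H^c_I(R) is nonzero is not shown by exhibiting a class: its annihilator is the
    prime p3, which does not contain 1. For the dimension of S / (V), adding the elements of U
    outside V one at a time gives a chain of primes of length d - |V| above (V). Conversely,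
    removing the elements of V one at a time prolongs any chain above (V) downwards by |V| steps,
    and dim S = d bounds the result. *)

Section Submodules.
Variables (R : comPzRingType) (M : lmodType R).
Implicit Types (K L : submodule M) (a b : R) (s t : seq R).

Lemma submodN K x : K x -> K (- x).
Proof. by move=> /(submodZ (-1)); rewrite scaleN1r. Qed.

Lemma submodB K x y : K x -> K y -> K (x - y).
Proof. by move=> Kx /submodN; apply: submodD. Qed.

Lemma submod_subl K x y : K (x - y) -> K x -> K y.
Proof. by move=> Kxy Kx; rewrite -[y](subKr x); apply: submodB. Qed.

Lemma submod_subr K x y : K (x - y) -> K y -> K x.
Proof. by move=> Kxy Ky; rewrite -[x](subrK y); apply: submodD. Qed.

(** This is K + aM, with membership as one congruence, so that a single witness is carried. In the
    module [R^o] it is the ideal K + (a). *)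
Program Definition adjoin K a : submodule M :=
  @Submodule _ _ [set x | exists y, K (x - a *: y)] _ _ _.
Next Obligation. by move=> K a; exists 0; rewrite scaler0 subr0; apply: submod0. Qed.
Next Obligation.
move=> K a x y [x' Kx] [y' Ky]; exists (x' + y').
by rewrite scalerDr opprD addrACA; apply: submodD.
Qed.
Next Obligation.
move=> K a b x [x' Kx]; exists (b *: x').
by rewrite scalerA mulrC -scalerA -scalerBr; apply: submodZ.
Qed.

Lemma sub_adjoin K a : K `<=` adjoin K a.
Proof. by move=> x Kx; exists 0; rewrite scaler0 subr0. Qed.

Lemma adjoin_scale K a x : adjoin K a (a *: x).
Proof. by exists x; rewrite subrr; apply: submod0. Qed.

Lemma adjoin_le K L a : K `<=` L -> (forall x, L (a *: x)) -> adjoin K a `<=` L.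
Proof. by move=> KL La x [y /KL /submod_subr]; apply. Qed.

Lemma adjoinS K L a : K `<=` L -> adjoin K a `<=` adjoin L a.
Proof. by move=> KL x [y /KL Lxy]; exists y. Qed.

Lemma adjoinC K a b : adjoin (adjoin K a) b = adjoin (adjoin K b) a.
Proof.
by apply: submodP => x; split=> -[y [z Kx]]; exists z, y; rewrite addrAC.
Qed.

Lemma adjoin_expS K a k x : adjoin K (a ^+ k) x -> adjoin K (a ^+ k.+1) (a *: x).
Proof. by move=> [y Kxy]; exists y; rewrite exprS -scalerA -scalerBr; apply: submodZ. Qed.

Fixpoint adjoins K s : submodule M :=
  if s is a :: s' then adjoin (adjoins K s') a else K.

Lemma adjoins_adjoin K s a : adjoins (adjoin K a) s = adjoins K (a :: s).
Proof. by elim: s => //= b s ->; rewrite adjoinC. Qed.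

Lemma sub_adjoins K s : K `<=` adjoins K s.
Proof. by elim: s => //= a s IHs; apply: subset_trans IHs (@sub_adjoin _ _). Qed.

Lemma adjoins_scale K s a x : a \in s -> adjoins K s (a *: x).
Proof.
elim: s => //= b s IHs; rewrite inE => /predU1P[->|/IHs]; first exact: adjoin_scale.
exact: sub_adjoin.
Qed.

Lemma adjoins_le K L s :
  K `<=` L -> (forall a x, a \in s -> L (a *: x)) -> adjoins K s `<=` L.
Proof.
move=> KL; elim: s => //= a s IHs Ls; apply: adjoin_le => [|x].
  by apply: IHs => b x bs; apply: Ls; rewrite inE bs orbT.
by apply: Ls; rewrite mem_head.
Qed.

Lemma adjoinsS K L s : K `<=` L -> adjoins K s `<=` adjoins L s.
Proof. by move=> KL; elim: s => //= a s IHs; apply: adjoinS. Qed.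

Definition regular K a := forall x, K (a *: x) -> K x.

(** Weak regularity on M / K: that the last quotient is nonzero is a separate hypothesis where it
    matters. *)
Fixpoint regseq K s : Prop :=
  if s is a :: s' then regular K a /\ regseq (adjoin K a) s' else True.

Lemma regseq_cat K s t : regseq K (s ++ t) <-> regseq K s /\ regseq (adjoins K s) t.
Proof.
elim: s K => [|a s IHs] K /=; first by split=> // -[].
rewrite IHs adjoins_adjoin /=; tauto.
Qed.

Lemma regularX K a n : regular K a -> regular K (a ^+ n).
Proof.
move=> Ka; elim: n => [|n IHn] x; first by rewrite expr0 scale1r.
by rewrite exprS -scalerA => /Ka/IHn.
Qed.

(* 0 -> M/K1 -> M/K2 -> M/(K2 + aM) -> 0 is exact, the first map being
   multiplication by a; regularity passes from the ends to the middle. *)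
Lemma regseq_ext K1 K2 a s :
  (forall x, K2 (a *: x) <-> K1 x) ->
  regseq K1 s -> regseq (adjoin K2 a) s -> regseq K2 s.
Proof.
elim: s K1 K2 => //= b s IHs K1 K2 K12 [K1b K1s] [Kb Ks]; split.
  move=> x Kbx; have /Kb[x1 Kx] : adjoin K2 a (b *: x) by apply: sub_adjoin.
  suff K1x1 : K1 x1 by apply: submod_subr Kx _; apply/K12.
  apply: K1b; apply/K12; rewrite scalerA mulrC -scalerA.
  by apply: (@submod_subl K2 (b *: x)) => //; rewrite -scalerBr; apply: submodZ.
apply: (IHs (adjoin K1 b)) => //; last by rewrite adjoinC.
move=> x; split=> [[y Kxy]|[y K1xy]]; last first.
  by exists (a *: y); rewrite scalerA mulrC -scalerA -scalerBr; apply/K12.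
have /Kb[z Kyz] : adjoin K2 a (b *: y).
  by exists x; rewrite -opprB; apply: submodN.
exists z; apply/K12; rewrite scalerBr; apply: (submod_subr _ Kxy).
suff -> : a *: x - a *: (b *: z) - (a *: x - b *: y) = b *: (y - a *: z).
  exact: submodZ.
by rewrite opprB addrCA addrAC subrr add0r scalerBr !scalerA mulrC addrC.
Qed.

(** Multiplication by a embeds M / (K + a^(n+1) M) into M / (K + a^(n+2) M) with cokernel M / (K +
    aM), so [regseq_ext] raises the exponent by one. *)
Lemma regseq_adjoinX K a s n :
  regular K a -> regseq (adjoin K a) s -> regseq (adjoin K (a ^+ n.+1)) s.
Proof.
move=> Ka Ks; elim: n => [|n IHn]; first by rewrite expr1.
apply: (@regseq_ext (adjoin K (a ^+ n.+1)) _ a) => // [x|].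
  split=> [[y Kxy]|]; last exact: adjoin_expS.
  by exists y; apply: Ka; rewrite scalerBr scalerA -exprS.
suff -> : adjoin (adjoin K (a ^+ n.+2)) a = adjoin K a by [].
apply: submodP => x; split; last exact/adjoinS/sub_adjoin.
apply: adjoin_le => [|y]; last exact: adjoin_scale.
apply: adjoin_le => [|y]; first exact: sub_adjoin.
by rewrite exprS -scalerA; apply: adjoin_scale.
Qed.

Lemma regseqX K s n : regseq K s -> regseq K [seq a ^+ n.+1 | a <- s].
Proof.
elim: s K => //= a s IHs K [Ka Ks]; split; first exact: regularX.
exact/IHs/regseq_adjoinX.
Qed.

Lemma regular_adjoinsX K s a n :
  regseq K (rcons s a) -> regular (adjoins K [seq b ^+ n.+1 | b <- s]) a.
Proof.
move=> /(@regseqX _ _ n); rewrite map_rcons -cats1 regseq_cat /= => -[_ [Ka _]] x Kx.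
by apply: Ka; rewrite exprSr -scalerA; apply: submodZ.
Qed.

(* The direct system M/(s^n)M, with transition maps multiplication by the
   powers of the product of s, has injective maps when s is regular in any order. *)
Lemma regseq_prodX K s k n x :
  (forall t, perm_eq t s -> regseq K t) ->
  adjoins K [seq a ^+ (n.+1 + k) | a <- s] ((\prod_(a <- s) a) ^+ k *: x) ->
  adjoins K [seq a ^+ n.+1 | a <- s] x.
Proof.
elim: s K x => [|a s IHs] K x Ks; first by rewrite big_nil expr1n scale1r.
rewrite big_cons exprMn mulrC -scalerA !map_cons -!adjoins_adjoin => /IHs-IH.
have /IH : forall t, perm_eq t s -> regseq (adjoin K (a ^+ (n.+1 + k))) t.
  move=> t ts; have /Ks /= [] : perm_eq (a :: t) (a :: s) by rewrite perm_cons.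
  by rewrite addSn; apply: regseq_adjoinX.
rewrite !adjoins_adjoin => -[y Kxy]; exists y.
(* The order with [a] first served the induction; the order with [a] last makes [a] regular modulo
   the powers of the others. *)
have Ka : regular (adjoins K [seq b ^+ n.+1 | b <- s]) a.
  by apply: regular_adjoinsX; apply: Ks; rewrite perm_rcons.
apply: (@regularX _ _ k Ka).
by rewrite scalerBr scalerA -exprD addnC.
Qed.

End Submodules.

(** * Ideals of a noetherian ring: chain conditions, weak Artin-Rees, Krull's intersection
    theorem *)

Section Ideals.
Variable R : comPzRingType.
Implicit Types (K L P Q I : ideal R) (a b x y : R) (s t : seq R).

Lemma ideal_mull K a x : K x -> K (a * x).
Proof. exact: (submodZ a). Qed.

Lemma ideal_mulr K a x : K x -> K (x * a).
Proof. by rewrite mulrC; apply: ideal_mull. Qed.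

Lemma adjoins_ideal_le K L s :
  K `<=` L -> (forall a, a \in s -> L a) -> adjoins K s `<=` L.
Proof. by move=> KL sL; apply: adjoins_le => // a x /sL/(@ideal_mulr _ x). Qed.

Lemma ideal_genE s : ideal_gen [set` s] = adjoins (zero_submod R^o) s.
Proof.
apply: submodP => x; split.
  apply=> a /= sa; rewrite -[a]mulr1; exact: (@adjoins_scale _ R^o).
move=> sx L sL; move: x sx; apply: adjoins_ideal_le => [x ->|a /sL//].
exact: submod0.
Qed.

Lemma sub_ideal_gen (A : set R) : A `<=` ideal_gen A.
Proof. by move=> a Aa K; apply. Qed.

Lemma ideal_gen_le (A : set R) K : A `<=` K -> ideal_gen A `<=` K.
Proof. by move=> AK x; apply. Qed.

Lemma adjoins_mem K s a : a \in s -> adjoins K s a.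
Proof. by move=> /(@adjoins_scale R R^o K _ _ 1); rewrite /GRing.scale /= mulr1. Qed.

Lemma adjoin_mem K a : adjoin K a a.
Proof. by exists 1; rewrite /GRing.scale /= mulr1 subrr; apply: submod0. Qed.

Lemma prime_idealX P a n : prime_ideal P -> P (a ^+ n) -> P a.
Proof.
move=> [P1 PM]; elim: n => [|n IHn]; first by rewrite expr0.
by rewrite exprS => /PM[|/IHn].
Qed.

Program Definition colon K a : ideal R := @Submodule _ _ [set x | K (a * x)] _ _ _.
Next Obligation. by move=> K a /=; rewrite mulr0; apply: submod0. Qed.
Next Obligation. by move=> K a x y Kx Ky /=; rewrite mulrDr; apply: submodD. Qed.
Next Obligation. by move=> K a b x Kx /=; rewrite mulrCA; apply: ideal_mull. Qed.

Program Definition ideal_scale K a : ideal R := @Submodule _ _ [set a * x | x in K] _ _ _.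
Next Obligation. by move=> K a; exists 0; [apply: submod0|rewrite mulr0]. Qed.
Next Obligation.
move=> K a _ _ [x Kx <-] [y Ky <-]; exists (x + y); first exact: submodD.
by rewrite mulrDr.
Qed.
Next Obligation.
by move=> K a b _ [x Kx <-]; exists (b * x); [apply: ideal_mull|rewrite mulrCA].
Qed.

Lemma chain_le (K : nat -> ideal R) m n :
  (forall n, K n `<=` K n.+1) -> (m <= n)%N -> K m `<=` K n.
Proof.
move=> Kn /subnK <-; elim: (n - m)%N => // k IHk.
exact: subset_trans IHk (Kn _).
Qed.

Program Definition chain_union (K : nat -> ideal R) (Kn : forall n, K n `<=` K n.+1) :
  ideal R := @Submodule _ _ [set x | exists n, K n x] _ _ _.
Next Obligation. by move=> K Kn; exists 0; apply: submod0. Qed.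
Next Obligation.
move=> K Kn x y [m Kx] [n Ky]; exists (maxn m n); apply: submodD.
  exact: (chain_le Kn (leq_maxl m n)).
exact: (chain_le Kn (leq_maxr m n)).
Qed.
Next Obligation. by move=> K Kn a x [n Kx]; exists n; apply: submodZ. Qed.

Hypothesis noethR : noetherian R.

Lemma noetherian_stable (K : nat -> ideal R) :
  (forall n, K n `<=` K n.+1) -> exists n, K n.+1 `<=` K n.
Proof.
move=> Kn; pose U := chain_union Kn.
have [s Us] := noethR U.
have [n sn] : exists n, [set` s] `<=` K n.
  have : [set` s] `<=` U by rewrite Us; apply: sub_ideal_gen.
  elim: s {Us} => [|a s IHs] sU; first by exists 0.
  have [|n sn] := IHs; first by move=> x sx; apply: sU; rewrite /= inE [x \in s]sx orbT.
  have [m am] : U a by apply: sU; rewrite /= mem_head.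
  exists (maxn m n) => x; rewrite /= inE => /predU1P[->|/sn].
    exact: (chain_le Kn (leq_maxl m n)).
  exact: (chain_le Kn (leq_maxr m n)).
exists n => x Kx; have : U x by exists n.+1.
by rewrite Us; apply: ideal_gen_le.
Qed.

(** Without a maximal member above K, iterating a choice of strictly larger members would give a
    strictly increasing sequence. *)
Lemma noetherian_max (F : ideal R -> Prop) K :
  F K -> exists L, [/\ F L, K `<=` L & forall L', F L' -> L `<=` L' -> L' `<=` L].
Proof.
move=> FK; apply: contrapT => nmax.
pose T := {L | F L /\ K `<=` L}.
have next (L : T) : exists L' : T, sval L `<=` sval L' /\ ~ sval L' `<=` sval L.
  case: L => L [FL KL] /=; apply: contrapT => nL; apply: nmax; exists L;
    split=> // L' FL' LL'.
  apply: contrapT => nL'; apply: nL.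
  by exists (exist _ L' (conj FL' (subset_trans KL LL'))).
pose f (L : T) : T := sval (cid (next L)).
pose K0 : T := exist _ K (conj FK (@subset_refl _ K)).
have [|n] := @noetherian_stable (fun n => sval (iter n f K0)).
  by move=> n /=; rewrite /f; case: cid => L' [].
by rewrite /= /f; case: cid => L' [].
Qed.

Lemma colonX_stable K a : exists k, forall x, K (a ^+ k.+1 * x) -> K (a ^+ k * x).
Proof.
have [n|k Kk] := @noetherian_stable (fun n => colon K (a ^+ n)); last by exists k => x /Kk.
by move=> x /= Kx; rewrite exprS -mulrA; apply: ideal_mull.
Qed.

(** One coincidence in the chain of ideals (K : a^n) propagates to all later ones: a single power of
    a kills the whole a-power torsion of R / K. *)
Lemma colonX_stableD K a :
  exists k, forall n x, K (a ^+ (k + n) * x) -> K (a ^+ k * x).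
Proof.
have [k Kk] := colonX_stable K a; exists k; elim=> [|n IHn] x; first by rewrite addn0.
rewrite addnS -addSn addnC exprD -mulrA mulrCA => /Kk.
by rewrite mulrCA mulrA -exprD addnC; apply: IHn.
Qed.

(* A weak Artin-Rees lemma: enlarge C to an ideal B as big as possible among
   those with B n A = C. *)
Lemma artin_rees (A C : ideal R) s :
  C `<=` A -> (forall a x, a \in s -> A x -> C (a * x)) ->
  exists B : ideal R, [/\ C `<=` B, forall x, B x -> A x -> C x
    & forall a, a \in s -> exists k, B (a ^+ k)].
Proof.
move=> CA sC.
have [//|B [BA CB Bmax]] := @noetherian_max (fun B : ideal R => forall x, B x -> A x ->
  C x) C.
exists B; split=> // a sa; have [k Bk] := colonX_stable B a; exists k.
(* The enlarged ideal still meets A inside C: if x is a^k r modulo B and lies in A, then a x lies in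
   C, so a^(k+1) r lies in B, hence a^k r by the choice of k, and x lies in B. *)
apply: (Bmax (adjoin B (a ^+ k))) => [x [r Bxr] Ax||].
- apply: BA => //; apply: (submod_subr Bxr); apply: Bk.
  have Bax := CB _ (sC _ _ sa Ax).
  rewrite exprS -mulrA; apply: (submod_subl _ Bax).
  by rewrite -mulrBr; apply: (ideal_mull a Bxr).
- exact: sub_adjoin.
- exact: adjoin_mem.
Qed.

(** Artin-Rees for A = P + (x) and C = P + (s)x gives B containing powers of s, hence x, so that x
    lies in C. Thus (1 - i) x lies in P for some i in P + (s), and 1 - i is outside P because P +
    (s) is proper. *)
Lemma krull_intersection P s x :
  prime_ideal P -> ~ adjoins P s 1 ->
  (forall n, adjoins P [seq a ^+ n.+1 | a <- s] x) -> P x.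
Proof.
move=> [_ PM] Ps1 Px.
pose A : ideal R := adjoin P x.
pose C : ideal R := adjoins P [seq a * x | a <- s].
have CA : C `<=` A.
  apply: adjoins_ideal_le => [|b /mapP[a sa ->]]; first exact: sub_adjoin.
  exact/ideal_mull/adjoin_mem.
have sC a y : a \in s -> A y -> C (a * y).
  move=> sa [z Pyz]; apply: (@submod_subr R R^o C _ (a * (x * z))).
    by apply: sub_adjoins; rewrite -mulrBr; apply: ideal_mull.
  by rewrite mulrA; apply: ideal_mulr; apply: adjoins_mem; apply: map_f.
have [B [CB BA Bs]] := artin_rees CA sC.
have [n Bn] : exists n, forall a, a \in s -> B (a ^+ n.+1).
  elim: s Bs {Ps1 Px C CA sC CB BA} => [_|a s IHs Bs]; first by exists 0.
  have [b sb|n Bn] := IHs; first by apply: Bs; rewrite inE sb orbT.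
  have [k Bk] := Bs a (mem_head _ _); exists (n + k)%N => b; rewrite inE =>
    /predU1P[->|/Bn].
    by rewrite -addSn exprD; apply: ideal_mull.
  by rewrite -addSn addnC exprD; apply: ideal_mull.
have /(BA x)/(_ (adjoin_mem _ _)) : B x.
  move: (Px n); apply: adjoins_ideal_le => [|_ /mapP[a sa ->]]; last exact: Bn.
  exact: subset_trans (@sub_adjoins _ _ _ _) CB.
have Cle : C `<=` [set y | exists2 i, adjoins P s i & P (y - i * x)].
  rewrite /C; elim: (s) => [|a l IHl] y /=; first by exists 0;
    [apply: submod0|rewrite mul0r subr0].
  move=> [z /IHl[i li Pyz]]; exists (i + a * z); first last.
    by move: Pyz; congr (submod_set P _); rewrite /GRing.scale /=; ring.
  by exists z; rewrite addrK.
move=> /Cle[i si Px1].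
have : P ((1 - i) * x) by rewrite mulrBl mul1r.
case/PM => // Pi; exfalso; apply: Ps1; apply: submod_subr si.
exact: sub_adjoins.
Qed.

End Ideals.

(** * Torsion in injective modules *)

Section InjectiveModules.
Variable R : comPzRingType.
Implicit Types (a b r : R) (s t : seq R).

Lemma submod_typeP (M : lmodType R) (N : submodule M) (x : submod_type N) : N (\val x).
Proof. by have /asboolP := valP x. Qed.

Section Extension.
Variables (E : lmodType R) (L : ideal R) (G : R^o -> E -> Prop).
Hypothesis G_total : forall x, L x -> exists y, G x y.
Hypothesis G_linear : forall (a : R) (x : R^o) y (x' : R^o) y',
  G x y -> G x' y' -> G (a *: x + x') (a *: y + y').
Hypothesis G_fun : forall y, G 0 y -> y = 0.

Let G_eq x y y' : G x y -> G x y' -> y = y'.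
Proof.
move=> Gxy Gxy'; apply/eqP; rewrite eq_sym -subr_eq0; apply/eqP/G_fun.
by have := G_linear (-1) Gxy Gxy'; rewrite !scaleN1r addNr addrC.
Qed.

Let g (x : submod_type L) : E := sval (cid (G_total (submod_typeP x))).

Let gP x : G (\val x) (g x).
Proof. by rewrite /g; case: cid. Qed.

Let g_linear : linear g.
Proof.
move=> a x y; apply: (G_eq (gP _)).
exact: (G_linear a (gP x) (gP y)).
Qed.

(** Baer's test for a map given by its graph [G]: the extension to R is multiplication by its value
    [h] at 1. With a graph, values need not be chosen before well-definedness is known. *)
Lemma injective_module_ext :
  injective_module E -> exists h, forall x, L x -> G x (x *: h).
Proof.
move=> injE.
pose gL : {linear submod_type L -> E} :=
  HB.pack g (GRing.isLinear.Build R (submod_type L) E _ g g_linear).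
have [f fE] := injE _ _ (\val : {linear submod_type L -> R^o}) gL val_inj.
exists (f 1) => x Lx; pose x' : submod_type L := Sub x (asboolT Lx).
have := gP x'; rewrite -[g x']fE /= -linearZ /=.
by congr (G _ (f _)); rewrite /GRing.scale /= mulr1.
Qed.

End Extension.

(** Equivalent to torsion for the ideal generated by s, see [Gamma_torsion]; stating it generator by
    generator lets generators be added one at a time. *)
Definition torsion s (M : lmodType R) (m : M) : Prop :=
  forall a, a \in s -> exists n, a ^+ n *: m = 0.

Section Torsion.
Variable M : lmodType R.
Implicit Types m : M.

Lemma torsion_cons a s m :
  torsion (a :: s) m <-> (exists n, a ^+ n *: m = 0) /\ torsion s m.
Proof.
split=> [sm|[am sm] b].
  split; first by apply: sm; rewrite mem_head.
  by move=> b bs; apply: sm; rewrite inE bs orbT.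
by rewrite inE => /predU1P[->|/sm].
Qed.

Lemma torsion0 s : torsion s (0 : M).
Proof. by move=> a _; exists 0%N; rewrite scaler0. Qed.

Lemma torsionD s m m' : torsion s m -> torsion s m' -> torsion s (m + m').
Proof.
move=> sm sm' a sa; have [[n am] [n' am']] := (sm a sa, sm' a sa).
by exists (n + n')%N; rewrite scalerDr {1}addnC !exprD -!scalerA am am' !scaler0 addr0.
Qed.

Lemma torsionZ s r m : torsion s m -> torsion s (r *: m).
Proof.
move=> sm a /sm[n am]; exists n.
by rewrite scalerA mulrC -scalerA am scaler0.
Qed.

Lemma torsionB s m m' : torsion s m -> torsion s m' -> torsion s (m - m').
Proof. by move=> sm sm'; rewrite -scaleN1r; apply: torsionD => //; apply: torsionZ. Qed.

Lemma torsion_exp s m : torsion s m -> exists n, forall a, a \in s -> a ^+ n *: m = 0.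
Proof.
elim: s => [|a s IHs]; first by exists 0%N.
move=> /torsion_cons[[k am] /IHs[n sm]]; exists (n + k)%N => b; rewrite inE.
case/predU1P=> [->|/sm bm]; first by rewrite exprD -scalerA am scaler0.
by rewrite addnC exprD -scalerA bm scaler0.
Qed.

End Torsion.

Lemma torsion_linear s (M N : lmodType R) (f : {linear M -> N}) m :
  torsion s m -> torsion s (f m).
Proof. by move=> sm a /sm[n am]; exists n; rewrite -linearZ am linear0. Qed.

(* The torsion part of an injective module maps onto its localization at a. *)
Lemma torsion_divisible (E : lmodType R) s a n (e : E) :
  noetherian R -> injective_module E -> torsion s e ->
  exists k h, torsion s h /\ a ^+ (k + n) *: h = a ^+ k *: e.
Proof.
move=> noethR injE se; have [k ak] := colonX_stableD noethR (zero_submod R^o) a.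
have {}ak r : a ^+ (k + n) * r = 0 -> a ^+ k * r = 0 by apply: ak.
have [m sem] := torsion_exp se.
set c := a ^+ (k + n) in ak *.
(* Artin-Rees for (c) and c ann(e): powers of s kill e, so they carry the first into the second. *)
pose A := ideal_scale (unit_ideal R) c; pose C := ideal_scale (ann_elt e) c.
have CA : C `<=` A by move=> _ [r _ <-]; exists r => //; apply: unit_idealE.
have sC b x : b \in [seq b ^+ m | b <- s] -> A x -> C (b * x).
  move=> /mapP[b' /sem be ->] [r _ <-]; exists (b' ^+ m * r); last exact: mulrCA.
  by rewrite /= mulrC -scalerA be scaler0.
have [B [CB BA sB]] := artin_rees noethR CA sC.
(* The map on B + (c) killing B and sending c r to a^k r e. It is well defined: if c r lies in B
   then c r = c r' with r' e = 0, and the choice of k turns a^(k+n) (r - r') = 0 into a^k (r - r') =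
   0. *)
pose G x y := exists2 r, B (x - c * r) & y = a ^+ k *: (r *: e).
have Gtot x : adjoin B c x -> exists y, G x y.
  by move=> [r Bxr]; exists (a ^+ k *: (r *: e)), r.
have [||h hE] := injective_module_ext Gtot _ _ injE.
- move=> b x _ x' _ [r Bxr ->] [r' Bxr' ->]; exists (b * r + r').
    have -> : b * x + x' - c * (b * r + r') = b * (x - c * r) + (x' - c * r') by ring.
    exact: submodD (ideal_mull b Bxr) Bxr'.
  by rewrite scalerDl scalerDr !scalerA; congr (_ *: _ + _); ring.
- move=> _ [r Bcr ->]; have {Bcr} : B (c * r).
    by move: Bcr; rewrite sub0r => /submodN; rewrite opprK.
  move=> /BA[|r' re /eqP]; first by exists r => //; apply: unit_idealE.
  rewrite -subr_eq0 -mulrBr => /eqP/ak/eqP; rewrite mulrBr subr_eq0 => /eqP akr.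
  by rewrite scalerA -akr -scalerA re scaler0.
have inB x : B x -> x *: h = 0.
  move=> Bx; have [|r Bxr ->] := hE x; first exact: sub_adjoin.
  have : B (c * r) by apply: submod_subl Bxr Bx.
  move=> /BA[|r' re /eqP]; first by exists r => //; apply: unit_idealE.
  rewrite -subr_eq0 -mulrBr => /eqP/ak/eqP; rewrite mulrBr subr_eq0 => /eqP akr.
  by rewrite scalerA -akr -scalerA re scaler0.
exists k, h; split.
  move=> b sb; have [q Bb] : exists q, B ((b ^+ m) ^+ q) by apply: sB; apply: map_f.
  by exists (m * q)%N; rewrite exprM; apply: inB.
(* The witness [r] for c need not be 1, but c (1 - r) lies in B, so a^k (1 - r) e = 0 as before. *)
have [|r Bcr ->] := hE c; first exact: adjoin_mem.
have : B (c * (1 - r)) by rewrite mulrBr mulr1.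
move=> /BA[|r' re /eqP]; first by exists (1 - r) => //; apply: unit_idealE.
rewrite -subr_eq0 -mulrBr => /eqP/ak/eqP; rewrite mulrBr subr_eq0 => /eqP akr.
have : a ^+ k *: ((1 - r) *: e) = 0 by rewrite scalerA -akr -scalerA re scaler0.
by rewrite scalerBl scale1r scalerBr => /eqP; rewrite subr_eq0 => /eqP.
Qed.

End InjectiveModules.

(** * Cohomology of the torsion complex of an injective resolution *)

Section ExprScale.
Variables (R : comPzRingType) (M : lmodType R).

Lemma expr_scale_eq (a : R) i j i' j' (x y : M) :
  a ^+ i *: x = a ^+ j *: y -> (i' + j = j' + i)%N -> (i <= i')%N ->
  a ^+ i' *: x = a ^+ j' *: y.
Proof.
move=> xy ij ii'; rewrite -(subnK ii') exprD -scalerA xy scalerA -exprD.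
by congr (_ ^+ _ *: _); lia.
Qed.

Lemma expr_scale_eq0 (a : R) i i' (x : M) :
  a ^+ i *: x = 0 -> (i <= i')%N -> a ^+ i' *: x = 0.
Proof. by move=> x0 /subnK <-; rewrite exprD -scalerA x0 scaler0. Qed.

End ExprScale.

Section TopLocalCohomology.
Variables (R : comPzRingType) (noethR : noetherian R).
Variables (N : lmodType R) (E : injective_resolution N).
Implicit Types (a r : R) (s t : seq R) (m : N) (i j k n : nat).

Notation d := (res_diff E).

Lemma res_diffK i x : d i.+1 (d i x) = 0.
Proof. by apply/res_exact; exists x. Qed.

Lemma res_diff_aug m : d 0 (res_aug E m) = 0.
Proof. by apply/res_exact0; exists m. Qed.

Definition cocycle s i (e : res_obj E i) := torsion s e /\ d i e = 0.

Definition coboundary s i : res_obj E i -> Prop :=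
  if i is j.+1 then fun e => exists f, torsion s f /\ d j f = e else fun e => e = 0.

Definition vanishes s i := forall e, cocycle s e -> @coboundary s i e.

Lemma coboundary0 s i : @coboundary s i 0.
Proof. by case: i => [|i] //=; exists 0; split; [apply: torsion0|apply: linear0]. Qed.

Lemma coboundary_linear s i r (e e' : res_obj E i) :
  coboundary s e -> coboundary s e' -> coboundary s (r *: e + e').
Proof.
case: i e e' => [|i] e e' /=; first by move=> -> ->; rewrite scaler0 addr0.
move=> [f [sf <-]] [f' [sf' <-]]; exists (r *: f + f'); rewrite linearP; split=> //.
by apply: torsionD => //; apply: torsionZ.
Qed.

Lemma coboundaryZ s i r (e : res_obj E i) : coboundary s e -> coboundary s (r *: e).
Proof.
by move=> /(@coboundary_linear _ _ r _ 0)/(_ (coboundary0 _ _)); rewrite addr0.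
Qed.

Lemma coboundaryD s i (e e' : res_obj E i) :
  coboundary s e -> coboundary s e' -> coboundary s (e + e').
Proof. by move=> /(@coboundary_linear _ _ 1)/[apply]; rewrite scale1r. Qed.

Lemma coboundaryN s i (e : res_obj E i) : coboundary s e -> coboundary s (- e).
Proof. by move=> /(@coboundaryZ _ _ (-1)); rewrite scaleN1r. Qed.

Lemma coboundaryB s i (e e' : res_obj E i) :
  coboundary s e -> coboundary s e' -> coboundary s (e - e').
Proof. by move=> se /coboundaryN; apply: coboundaryD. Qed.

Lemma coboundary_cocycle s i (e : res_obj E i) : coboundary s e -> cocycle s e.
Proof.
case: i e => [|i] e /=; first by move->; split; [apply: torsion0|apply: linear0].
by move=> [f [sf <-]]; split; [apply: torsion_linear|apply: res_diffK].
Qed.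

Lemma cocycle_cons a s i (e : res_obj E i) :
  cocycle (a :: s) e <-> (exists k, a ^+ k *: e = 0) /\ cocycle s e.
Proof. rewrite /cocycle torsion_cons; tauto. Qed.

(** Coboundaries in positive degree are images of torsion elements of an injective module, so they
    inherit [torsion_divisible]. *)
Lemma coboundary_divisible a s i n (b : res_obj E i) :
  coboundary s b ->
  exists k b', coboundary s b' /\ a ^+ (k + n) *: b' = a ^+ k *: b.
Proof.
case: i b => [|i] b /=; first by move->; exists 0%N, 0; rewrite !scaler0.
move=> [f [sf <-]].
have [k [h [sh hE]]] := torsion_divisible a n noethR (@res_injective _ _ E i) sf.
exists k, (d i h); split; first by exists h.
by rewrite -!linearZ hE.
Qed.

(** If e = d f and a^k e = 0, then a^k f is a cocycle, hence a coboundary, and can be divided by a^k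
    up to a power of a. Subtracting the quotient makes f torsion for a as well. In other words, H^i
    for [a :: s] embeds into H^i for s when H^(i-1) for s vanishes. *)
Lemma coboundary_cons a s i (e : res_obj E i) :
  (forall j, i = j.+1 -> vanishes s j) ->
  cocycle (a :: s) e -> coboundary s e -> coboundary (a :: s) e.
Proof.
case: i e => [|i] e van //= /cocycle_cons[[k ae] _] [f [sf fE]].
have [|q [b' [sb' b'E]]] := @coboundary_divisible a s i k (a ^+ k *: f).
  by apply: (van i erefl); split; [apply: torsionZ|rewrite linearZ fE].
exists (f - b'); have [tb' db'] := coboundary_cocycle sb'.
rewrite linearB db' fE subr0; split=> //; apply/torsion_cons; split; last exact: torsionB.
by exists (q + k)%N; rewrite scalerBr b'E scalerA -exprD subrr.
Qed.

Lemma vanishes_cons a s i :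
  (forall j, i = j.+1 -> vanishes s j) -> vanishes s i -> vanishes (a :: s) i.
Proof. by move=> van vani e ae; apply: coboundary_cons => //; apply: vani;
  case/cocycle_cons: ae. Qed.

Variable s0 : seq R.
Hypothesis s0N : forall a m, a \in s0 -> a *: m = 0.

(** Degree 1 is the delicate one, H^0 being possibly nonzero: there a^k f is a degree-0 cocycle, so
    it comes from N and is killed by one more factor a. *)
Lemma vanishes_annihilated i : vanishes s0 i.+1.
Proof.
elim: s0 s0N i => [_ i e [_ /res_exact[f <-]]|a s IHs sN i]; first by exists f.
have {}IHs : forall i, vanishes s i.+1.
  by apply: IHs => b m bs; apply: sN; rewrite inE bs orbT.
case: i => [|i]; last by apply: vanishes_cons => // j [<-].
move=> e /cocycle_cons[[k ae] /IHs[f [sf fE]]]; exists f; split=> //.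
apply/torsion_cons; split=> //; exists k.+1.
have /res_exact0[m mE] : d 0 (a ^+ k *: f) = 0 by rewrite linearZ fE.
by rewrite exprS -scalerA -mE -linearZ sN ?linear0 ?mem_head.
Qed.

Lemma vanishes_gt s i : (size s < i)%N -> vanishes (s ++ s0) i.
Proof.
elim: s i => [|a s IHs] [|i] //= si; first exact: vanishes_annihilated.
by apply: vanishes_cons => [j [<-]|]; apply: IHs => //; apply: ltnW.
Qed.

(* e represents the fraction m / s^n in the top local cohomology module, read
   as the cokernel of H^(i-1)_s -> (H^(i-1)_s)_a. *)
Fixpoint fraction s n m : res_obj E (size s) -> Prop :=
  match s return res_obj E (size s) -> Prop with
  | [::] => fun e => e = res_aug E m
  | a :: s' => fun e => exists k h f,
      [/\ torsion (s' ++ s0) h, fraction n m f,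
          a ^+ (k + n) *: h = a ^+ k *: f & e = d (size s') h]
  end.

Lemma fraction_cocycle s n m (e : res_obj E (size s)) :
  fraction n m e -> cocycle (s ++ s0) e.
Proof.
elim: s e => [|a s IHs] e /=.
  move=> ->; split; last exact: res_diff_aug.
  by move=> a /s0N am; exists 1%N; rewrite expr1 -linearZ am linear0.
move=> [k [h [f [sh /IHs[_ df] hf ->]]]]; split; last exact: res_diffK.
apply/torsion_cons; split; last exact: torsion_linear.
exists (k + n)%N; have <- :
  d _ (a ^+ (k + n) *: h) = a ^+ (k + n) *: d _ h by rewrite linearZ.
by rewrite hf linearZ /= df scaler0.
Qed.

Lemma fraction_exists s n m : exists e : res_obj E (size s), fraction n m e.
Proof.
elim: s => [|a s [f mf]] /=; first by eexists.
have [sf _] := fraction_cocycle mf.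
have [k [h [sh hE]]] := torsion_divisible a n noethR (@res_injective _ _ E _) sf.
by exists (d _ h), k, h, f.
Qed.

Lemma fraction_linear s n r m m' (e e' : res_obj E (size s)) :
  fraction n m e -> fraction n m' e' -> fraction n (r *: m + m') (r *: e + e').
Proof.
elim: s e e' => [|a s IHs] e e' /=; first by move=> -> ->; rewrite linearP.
move=> [k [h [f [sh mf hE ->]]]] [k' [h' [f' [sh' mf' hE' ->]]]].
exists (k + k')%N, (r *: h + h'), (r *: f + f'); split; last by rewrite linearP.
- by apply: torsionD => //; apply: torsionZ.
- exact: IHs.
rewrite !scalerDr !(scalerA _ r) !(mulrC _ r) -!scalerA.
by congr (r *: _ + _); [apply: (expr_scale_eq hE)|apply: (expr_scale_eq hE')]; lia.
Qed.

Lemma fractionZ s n r m (e : res_obj E (size s)) :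
  fraction n m e -> fraction n (r *: m) (r *: e).
Proof.
have z : fraction n 0 (0 : res_obj E (size s)).
  have [f mf] := fraction_exists s n 0.
  by have := fraction_linear (-1) mf mf; rewrite !scaleN1r oppr0 addr0 addNr.
by move=> me; have := fraction_linear r me z; rewrite !addr0.
Qed.

Lemma fractionB s n m m' (e e' : res_obj E (size s)) :
  fraction n m e -> fraction n m' e' -> fraction n (m - m') (e - e').
Proof. by move=> me me'; have := fraction_linear (-1) me' me;
  rewrite !scaleN1r ![- _ + _]addrC. Qed.

Notation prod s := (\prod_(a <- s) a).

(** Enlarging the denominator does not change the class. By induction a^k f and f' differ by a
    coboundary; divided by a^(n+k), it corrects h - h' into an a-torsion element. *)
Lemma fraction_lift s n k m (e e' : res_obj E (size s)) :
  fraction n m e -> fraction (n + k) (prod s ^+ k *: m) e' ->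
  coboundary (s ++ s0) (e - e').
Proof.
elim: s m e e' => [|a s IHs] m e e'.
  by rewrite big_nil expr1n scale1r /= => -> ->; rewrite subrr.
rewrite big_cons exprMn mulrC -scalerA => -[p [h [f [sh mf hE ->]]]].
move=> [q [h' [f' [sh' mf' hE' ->]]]].
have /(@coboundary_divisible a _ _ (n + k))[w [b [sb bE]]] :=
  IHs _ _ _ (fractionZ (a ^+ k) mf) mf'.
have [tb db] := coboundary_cocycle sb.
exists (h - h' - b); split; last by rewrite !linearB db subr0.
apply/torsion_cons; split; last by apply: torsionB => //; apply: torsionB.
exists (p + q + w + n + k)%N; rewrite !scalerBr.
have -> : a ^+ (p + q + w + n + k) *: h = a ^+ (p + q + w + k) *: f.
  by apply: (expr_scale_eq hE); lia.
have -> : a ^+ (p + q + w + n + k) *: h' = a ^+ (p + q + w) *: f'.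
  by apply: (expr_scale_eq hE'); lia.
have -> : a ^+ (p + q + w + n + k) *: b = a ^+ (p + q + w) *: (a ^+ k *: f - f').
  by apply: (expr_scale_eq bE); lia.
by rewrite scalerBr scalerA -exprD subrr.
Qed.

(** Write m as a^n m0 modulo the powers of s. Then f is a^n f0 up to a coboundary, so h agrees with
    the cocycle f0 up to a coboundary and a-torsion. *)
Lemma fraction_denominator s n m (e : res_obj E (size s)) :
  fraction n m e -> adjoins (zero_submod N) [seq a ^+ n | a <- s] m ->
  coboundary (s ++ s0) e.
Proof.
elim: s m e => [|a s IHs] m e /=; first by move=> -> ->; rewrite linear0.
move=> [k [h [f [sh mf hE ->]]]] [m0 m0s].
have [f0 mf0] := fraction_exists s n m0.
have := IHs _ _ (fractionB mf (fractionZ (a ^+ n) mf0)) m0s.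
move=> /(@coboundary_divisible a _ _ n)[w [b [sb bE]]].
have [tb db] := coboundary_cocycle sb; have [tf0 df0] := fraction_cocycle mf0.
exists (h - f0 - b); split; last by rewrite !linearB db df0 !subr0.
apply/torsion_cons; split; last by apply: torsionB => //; apply: torsionB.
exists (k + w + n)%N; rewrite !scalerBr.
have -> : a ^+ (k + w + n) *: h = a ^+ (k + w) *: f by apply: (expr_scale_eq hE); lia.
have -> : a ^+ (k + w + n) *: b = a ^+ (k + w) *: (f - a ^+ n *: f0).
  by apply: (expr_scale_eq bE); lia.
by rewrite scalerBr scalerA -exprD subrr.
Qed.

(** Cohomology for s vanishes above its length, so e = d f with a^k f a cocycle, by induction a
    fraction m / s^n. Hence e is m / (s^n a^k), brought to the common exponent n + k. *)
Lemma fraction_surj s (e : res_obj E (size s)) : cocycle (s ++ s0) e ->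
  exists n m e', fraction n m e' /\ coboundary (s ++ s0) (e - e').
Proof.
elim: s e => [|a s IHs] e; first by move=> [_ /res_exact0[m <-]];
  exists 0%N, m, (res_aug E m); rewrite subrr.
move=> /cocycle_cons[[k ae]]; rewrite -/cat.
move=> /(vanishes_gt (ltnSn _))[f [sf fE]].
have /IHs[n [m [g [mg sfg]]]] : cocycle (s ++ s0) (a ^+ k *: f).
  by split; [apply: torsionZ|rewrite linearZ fE].
have [g' mg'] := fraction_exists s (n + k) (prod s ^+ k *: m).
have := coboundaryD sfg (fraction_lift mg mg'); rewrite addrA subrK.
move=> /(@coboundary_divisible a _ _ k)[w [b [sb bE]]].
have [tb db] := coboundary_cocycle sb.
exists (n + k)%N, (a ^+ n *: (prod s ^+ k *: m)), e; split; last first.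
  by rewrite subrr; apply: coboundary0.
exists w, (f - b), (a ^+ n *: g'); split; last by rewrite linearB db subr0.
- exact: torsionB.
- exact: fractionZ.
rewrite scalerBr; have -> : a ^+ (w + (n + k)) *: b = a ^+ (w + n) *: (a ^+ k *: f - g').
  by apply: (expr_scale_eq bE); lia.
by rewrite scalerBr !scalerA -!exprD -!addnA subKr.
Qed.

Lemma adjoins_prodX (M : lmodType R) s n k (m : M) :
  adjoins (zero_submod M) [seq a ^+ n | a <- s] m ->
  adjoins (zero_submod M) [seq a ^+ (n + k) | a <- s] (prod s ^+ k *: m).
Proof.
elim: s m => [|a s IHs] m; first by move=> /= ->; rewrite scaler0.
move=> -[y /IHs sy]; exists (prod s ^+ k *: y).
rewrite big_cons exprMn -scalerA exprD (mulrC (a ^+ n)) -scalerA -scalerBr.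
apply: submodZ; move: sy; rewrite scalerBr; congr (submod_set _ (_ - _)).
by rewrite !scalerA mulrC.
Qed.

(** The converse of [fraction_denominator]. If d h = d g with g torsion for [a :: s], then h - g is
    a cocycle for s, hence some m' / s^n', and m / s^n agrees with a^n m' / s^n' after
    multiplication by a power of a. The induction hypothesis applies to the difference over the
    common denominator. *)
Lemma fraction_coboundary s n m (e : res_obj E (size s)) :
  fraction n m e -> coboundary (s ++ s0) e ->
  exists k, adjoins (zero_submod N) [seq a ^+ (n + k) | a <- s] (prod s ^+ k *: m).
Proof.
elim: s n m e => [|a s IHs] n m e.
  move=> -> /= me; exists 0%N; rewrite expr0 scale1r; apply: (@res_aug_inj _ _ E).
  by rewrite linear0.
move=> [k [h [f [sh mf hE ->]]]] [g [/torsion_cons[[p ag] sg] dg]].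
pose K := (k + p)%N; have hgE : a ^+ (K + n) *: (h - g) = a ^+ K *: f.
  rewrite scalerBr (expr_scale_eq0 ag) ?subr0; last by rewrite /K; lia.
  by apply: (expr_scale_eq hE); rewrite /K; lia.
have [n' [m' [u [mu su]]]] :
  exists n m e', fraction n m e' /\ coboundary (s ++ s0) (h - g - e').
  by apply: fraction_surj; split; [apply: torsionB|rewrite linearB dg subrr].
have [u' mu'] := fraction_exists s (n' + n) (prod s ^+ n *: m').
have [f' mf'] := fraction_exists s (n + n') (prod s ^+ n' *: m).
have su' := coboundaryD su (fraction_lift mu mu'); rewrite addrA subrK in su'.
have sf' := fraction_lift mf mf'; rewrite addnC in mf'.
have := fractionB (fractionZ (a ^+ K) mf') (fractionZ (a ^+ (K + n)) mu').
move=> /IHs[|q].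
  have -> : a ^+ K *: f' - a ^+ (K + n) *: u' =
      a ^+ (K + n) *: (h - g - u') - a ^+ K *: (f - f').
    move: (h - g) hgE => w hgE.
    by rewrite !scalerBr hgE opprB [RHS]addrC addrA subrK.
  by apply: coboundaryB; apply: coboundaryZ.
move=> /(@adjoins_prodX _ _ _ K)/(submodZ (a ^+ (n' + q))) smq.
(* Here n' comes from the common denominator, q from the induction hypothesis, and K from the power
   of a. *)
exists (n' + q + K)%N; exists (prod s ^+ (K + q + n) *: m').
rewrite big_cons exprMn.
have -> : (n + (n' + q + K) = n' + n + q + K)%N by lia.
move: smq; congr (submod_set _ _).
rewrite !scalerBr !scalerA; congr (_ *: _ - _ *: _).
  by rewrite !exprD; ring.
by rewrite !exprD; ring.
Qed.

(** Fractions exhaust the top cocycles up to coboundary, and r acts on numerators. *)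
Lemma top_annihilator s r :
  (forall e : res_obj E (size s), cocycle (s ++ s0) e -> coboundary (s ++ s0) (r *: e)) <->
  (forall n m, exists k,
     adjoins (zero_submod N) [seq a ^+ (n + k) | a <- s] (prod s ^+ k *: (r *: m))).
Proof.
split=> [rH n m|rH e /fraction_surj[n [m [f [mf sf]]]]].
  have [e me] := fraction_exists s n m.
  exact/(fraction_coboundary (fractionZ r me))/rH/(fraction_cocycle me).
rewrite -(subrK f e) scalerDr; apply: coboundaryD; first exact: coboundaryZ.
have [k sk] := rH n m.
have [g mg] := fraction_exists s (n + k) (prod s ^+ k *: (r *: m)).
have := fraction_lift (fractionZ r mf) mg.
by move=> /coboundaryD/(_ (fraction_denominator mg sk)); rewrite subrK.
Qed.

Definition regular_anyorder s := forall t, perm_eq t s -> regseq (zero_submod N) t.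

Lemma regular_anyorder_cons a s : regular_anyorder (a :: s) -> regular_anyorder s.
Proof.
move=> as_reg t ts; have /as_reg : perm_eq (t ++ [:: a]) (a :: s).
  by rewrite cats1 perm_rcons perm_cons.
by rewrite regseq_cat => -[].
Qed.

(** For [a :: s] only the degree [size s] is new. There e is a fraction m / s^(n+1) up to a
    coboundary; as a^k e = 0, injectivity of the direct system puts a^k m in (s^(n+1)) N. Since a is
    regular modulo powers of s, m lies there too, and e is a coboundary for s. *)
Lemma vanishes_lt s i : regular_anyorder s -> (i < size s)%N -> vanishes (s ++ s0) i.
Proof.
elim: s i => [|a s IHs] i // as_reg; have {}IHs j := IHs j (regular_anyorder_cons as_reg).
rewrite /= ltnS leq_eqVlt => /predU1P[->|i_s]; last first.
  by apply: vanishes_cons => [j ij|]; apply: IHs => //; rewrite -ltnS -ij ltnW.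
move=> e ae; apply: coboundary_cons => // [j js|]; first by apply: IHs; rewrite js.
have /cocycle_cons[[k ek] /fraction_surj[n [m [f [mf sf]]]]] := ae.
(* The exponent is raised by one because [regseq_prodX] requires it to be positive. *)
have [g mg] := fraction_exists s (n + 1) (prod s ^+ 1 *: m).
have := coboundaryD sf (fraction_lift mf mg); rewrite addrA subrK => sg.
rewrite -(subrK g e); apply: coboundaryD => //.
apply: (fraction_denominator mg); rewrite addn1 in mg *.
have a_reg : regular (adjoins (zero_submod N) [seq a ^+ n.+1 | a <- s]) a.
  by apply: regular_adjoinsX; apply: as_reg; rewrite perm_rcons.
apply: (@regularX _ _ _ _ k a_reg).
have /(fraction_coboundary (fractionZ (a ^+ k) mg))[q] : coboundary (s ++ s0) (a ^+ k *: g).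
  have /coboundaryN := coboundaryZ (a ^+ k) sg.
  by rewrite scalerBr ek sub0r opprK.
apply: regseq_prodX; exact: regular_anyorder_cons as_reg.
Qed.

Lemma vanishes_top s : regular_anyorder s -> vanishes (s ++ s0) (size s) ->
  forall m, adjoins (zero_submod N) s m.
Proof.
move=> s_reg van m; have [e me] := fraction_exists s 1 m.
have [k] := fraction_coboundary me (van e (fraction_cocycle me)).
move=> /(regseq_prodX s_reg).
by rewrite (eq_map (fun a => expr1 a)) map_id.
Qed.

End TopLocalCohomology.

(** * Existence of injective resolutions *)

(** [zmodule] views Q as a module over the integers, which makes Q / Z a [quot_module]. *)
Definition rat_integers_set : set (zmodule rat) :=
  [set x | exists n : int, x = n%:~R :> rat].

Program Definition rat_integers : submodule (zmodule rat) :=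
  @Submodule _ _ rat_integers_set _ _ _.
Next Obligation. by exists 0. Qed.
Next Obligation. by move=> _ _ [m ->] [n ->]; exists (m + n); rewrite rmorphD. Qed.
Next Obligation. by move=> a _ [n ->]; exists (a * n);
  rewrite /GRing.scale /= -mulrzA mulrC. Qed.

(* Q / Z *)
Definition circle : zmodType := quot_module rat_integers.

Lemma circle_divisible (y : circle) n : (0 < n)%N -> exists z : circle, z *+ n = y.
Proof.
move=> n_gt0; have [x <-] := quot_pi_surj y.
exists (quot_pi rat_integers ((x : rat) / n%:R : rat)); rewrite -raddfMn; congr quot_pi.
by rewrite -[LHS]mulr_natr divfK // pnatr_eq0 -lt0n.
Qed.

Lemma circle_torsion n : (1 < n)%N -> exists y : circle, y <> 0 /\ y *+ n = 0.
Proof.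
move=> n_gt1; have n_neq0 : n%:R != 0 :> rat by rewrite pnatr_eq0 -lt0n ltnW.
exists (quot_pi rat_integers (n%:R^-1 : rat)); split.
  rewrite -(raddf0 (quot_pi rat_integers)) => /quot_piE[k]; rewrite subr0 =>
    /(congr1 (fun z => z * n%:R)).
  rewrite mulVf // => /eqP;
    rewrite -[n%:R]/(n%:Z%:~R) -intrM eq_sym -[1]/(1%:~R) eqr_int => /eqP kn.
  by have /(congr1 absz) := kn; rewrite abszM /= => /eqP; rewrite muln_eq1 =>
    /andP[_ /eqP n1]; rewrite n1 in n_gt1.
rewrite -raddfMn -(raddf0 (quot_pi rat_integers)); apply/quot_piE; exists 1.
by rewrite subr0 -[LHS]mulr_natr mulVf.
Qed.

(** * Extension of characters with values in Q / Z *)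

Section Characters.
Variable A : zmodType.
Implicit Types (G H : set (A * circle)).

(** The graph of a homomorphism from a subgroup of A to the circle. *)
Definition functional_subgroup G :=
  [/\ G (0, 0),
      forall x y x' y', G (x, y) -> G (x', y') -> G (x - x', y - y')
    & forall y, G (0, y) -> y = 0].

Lemma functional_subgroupMz G x y (n : int) :
  functional_subgroup G -> G (x, y) -> G (x *~ n, y *~ n).
Proof.
move=> [G0 GB _] Gxy.
have GN x' y' : G (x', y') -> G (- x', - y') by move=> /(GB _ _ _ _ G0); rewrite !sub0r.
have Gn k : G (x *+ k, y *+ k).
  elim: k => [|k IHk] //; rewrite !mulrS -{1}[x *+ k]opprK -[y *+ k]opprK.
  exact/(GB _ _ _ _ Gxy)/GN.
by case: n => k; [apply: Gn|rewrite NegzE !mulrNz; apply/GN/Gn].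
Qed.

Lemma functional_subgroup_adjoin G b c :
  functional_subgroup G -> (forall n z, G (b *~ n, z) -> z = c *~ n) ->
  functional_subgroup
    [set p | exists q n, [/\ G q, p.1 = q.1 + b *~ n & p.2 = q.2 + c *~ n]].
Proof.
move=> [G0 GB Gfun] bc; split.
- by exists (0, 0), 0; rewrite !mulr0z !addr0.
- move=> x y x' y' [[p1 p2] [m [Gp /= -> ->]]] [[q1 q2] [n [Gq /= -> ->]]].
  exists (p1 - q1, p2 - q2), (m - n); split => /=; first exact: GB.
    by rewrite mulrzBr opprD addrACA.
  by rewrite mulrzBr opprD addrACA.
move=> y [[q1 q2] [n [Gq /= /esym/eqP]]]; rewrite addr_eq0 -mulrNz => /eqP q1E ->.
by rewrite (bc (- n) q2) -?q1E // mulrNz addNr.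
Qed.

(* The integers n with n b in the domain of G form a subgroup k Z; divisibility
   provides a value at b compatible with the value at k b. *)
Lemma functional_subgroup_value G b : functional_subgroup G ->
  exists c, forall n z, G (b *~ n, z) -> z = c *~ n.
Proof.
move=> fG; have [G0 GB Gfun] := fG.
case: (pselect (exists k, (0 < k)%N && `[< exists z, G (b *+ k, z) >])) => [exk|nk].
  case: (ex_minnP exk) => k /andP[k_gt0 /asboolP[z Gkz]] kmin.
  have [c cz] := circle_divisible z k_gt0; exists c => n w Gnw.
  have nE : (n %% k)%Z = n - k%:Z * (n %/ k)%Z.
    by apply/eqP; rewrite eq_sym subr_eq addrC mulrC -divz_eq.
  have Gr : G (b *~ (n %% k)%Z, w - z *~ (n %/ k)%Z).
    have := GB _ _ _ _ Gnw (functional_subgroupMz (n %/ k)%Z fG Gkz).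
    by rewrite -[b *+ k]/(b *~ k) -mulrzA -mulrzBr -nE.
  have r_ge0 : (0 <= n %% k)%Z by rewrite modz_ge0 // -lt0n.
  have r_lt : (n %% k < k)%Z by rewrite ltz_pmod.
  have r0 : (n %% k)%Z = 0.
    case: (n %% k)%Z r_ge0 r_lt Gr => // -[|r] // _ rk Gr.
    move: rk; rewrite ltz_nat ltnNge => /negP[]; apply: kmin.
    by apply/andP; split=> //; apply/asboolP; exists (w - z *~ (n %/ k)%Z).
  move: Gr; rewrite r0 mulr0z => /Gfun/eqP; rewrite subr_eq0 => /eqP ->.
  by rewrite -cz -[c *+ k]/(c *~ k) -mulrzA mulrC [in RHS](divz_eq n k) r0 addr0.
exists 0 => n z; rewrite mul0rz.
case: n => [[|n] Gnz|n Gnz]; first by apply: Gfun; rewrite mulr0z in Gnz.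
  by case: nk; exists n.+1; apply/asboolP; exists z.
case: nk; exists n.+1; apply/asboolP; exists (z *~ (-1)).
by have := functional_subgroupMz (-1) fG Gnz; rewrite NegzE -mulrzA mulrNN mulr1.
Qed.

Lemma character_extension G : functional_subgroup G ->
  exists f : {additive A -> circle}, forall x y, G (x, y) -> f x = y.
Proof.
(* Zorn's lemma is applied to sets whose union with G is functional, so that the empty chain is
   bounded too. *)
move=> fG; pose P H := functional_subgroup (G `|` H).
have [F FP Ftot|H [fH Hmax]] := @Zorn_bigcup _ P.
  have two H1 H2 : F H1 -> F H2 -> exists H, [/\ F H, H1 `<=` H & H2 `<=` H].
    move=> F1 F2; case: (Ftot _ _ F1 F2) => h; [exists H2|exists H1]; split=> //;
      exact: subset_refl.
  have pick p : (G `|` \bigcup_(X in F) X) p -> G p \/ exists2 H, F H & H p.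
    by move=> [Gp|[H FH Hp]]; [left|right; exists H].
  have [G0 GB Gfun] := fG.
  split; first by left.
    move=> x y x' y' /pick[Gp|[H FH Hp]] /pick[Gq|[H' FH' Hq]].
    - by left; apply: GB.
    - have [_ HB _] := FP _ FH'.
      by case: (HB _ _ _ _ (or_introl Gp) (or_intror Hq)); [left|right; exists H'].
    - have [_ HB _] := FP _ FH.
      by case: (HB _ _ _ _ (or_intror Hp) (or_introl Gq)); [left|right; exists H].
    have [K [FK HK H'K]] := two _ _ FH FH'; have [_ KB _] := FP _ FK.
    by case: (KB _ _ _ _ (or_intror (HK _ Hp)) (or_intror (H'K _ Hq))); [left|right;
      exists K].
  move=> y /pick[/Gfun//|[H FH Hy]].
  by have [_ _ Hfun] := FP _ FH; apply: Hfun; right.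
set T := G `|` H in fH; have [T0 TB Tfun] := fH.
have Ttot b : exists c, T (b, c).
  have [c bc] := functional_subgroup_value b fH; exists c; apply: contrapT => nT.
  have := functional_subgroup_adjoin fH bc.
  set T' := [set _ | _] => fT'.
  have TT' : T `<=` T'.
    by move=> p Tp; exists p, 0; rewrite !mulr0z !addr0.
  have T'bc : T' (b, c) by exists (0, 0), 1; rewrite !mulr1z !add0r.
  apply: (Hmax T').
    split; first by move=> p Hp; apply: TT'; right.
    by move=> T'H; apply: nT; right; apply: T'H.
  by rewrite /P (_ : _ `|` _ = T') //; apply/seteqP; split=> p; [case=> // Gp;
    apply: TT'; left|right].
pose f x := sval (cid (Ttot x)).
have fE x : T (x, f x) by rewrite /f; case: cid.
have Tf x y : T (x, y) -> f x = y.
  move=> Txy; apply/eqP; rewrite -subr_eq0; apply/eqP/Tfun.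
  by have := TB _ _ _ _ (fE x) Txy; rewrite subrr.
have f_additive : zmod_morphism f by move=> x y; apply: Tf; apply: TB; apply: fE.
pose fA : {additive A -> circle} := HB.pack f (GRing.isZmodMorphism.Build _ _ f f_additive).
by exists fA => x y Gxy; apply: Tf; left.
Qed.

(** The value prescribed at x is a nonzero element killed by the order of x, or a nonzero element
    killed by 2 when x has infinite order. *)
Lemma character_separates x : x <> 0 -> exists f : {additive A -> circle}, f x <> 0.
Proof.
move=> x_neq0.
have [c [c_neq0 xc]] : exists c : circle, c <> 0 /\ forall n, x *~ n = 0 -> c *~ n = 0.
  case: (pselect (exists k, (0 < k)%N && (x *+ k == 0))) => [exk|nk].
    case: (ex_minnP exk) => k /andP[k_gt0 /eqP xk] kmin.
    have k_gt1 : (1 < k)%N.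
      by case: k k_gt0 xk {kmin} => [|[|k]] // _; rewrite mulr1n => /x_neq0.
    have [c [c_neq0 ck]] := circle_torsion k_gt1; exists c; split=> // n xn.
    have xr : x *~ (n %% k)%Z = 0.
      by move: xn;
        rewrite {1}(divz_eq n k) mulrzDr mulrC mulrzA -[x *~ k]/(x *+ k) xk mul0rz add0r.
    have r_ge0 : (0 <= n %% k)%Z by rewrite modz_ge0 // -lt0n.
    have r_lt : (n %% k < k)%Z by rewrite ltz_pmod.
    have r0 : (n %% k)%Z = 0.
      case: (n %% k)%Z r_ge0 r_lt xr => // -[|r] // _ rk xr.
      move: rk; rewrite ltz_nat ltnNge => /negP[]; apply: kmin.
      by rewrite -[x *+ r.+1]/(x *~ r.+1) xr eqxx.
    by rewrite (divz_eq n k) r0 addr0 mulrC mulrzA -[c *~ k]/(c *+ k) ck mul0rz.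
  have [c [c_neq0 _]] := @circle_torsion 2 isT; exists c; split=> // -[[|n]|n] xn //.
    by case: nk; exists n.+1; rewrite -[x *+ n.+1]/(x *~ n.+1) xn eqxx.
  case: nk; exists n.+1; move/eqP: xn; rewrite NegzE mulrNz oppr_eq0.
  by rewrite -[x *~ _]/(x *+ n.+1) => ->.
have f0 : functional_subgroup [set ((0 : A), (0 : circle))].
  split=> // [x1 y1 x2 y2 [-> ->] [-> ->]|y [->]] //.
  by rewrite /= !subr0.
have xc' n z : [set ((0 : A), (0 : circle))] (x *~ n, z) -> z = c *~ n.
  by move=> [/xc -> ->].
have [f fE] := character_extension (functional_subgroup_adjoin f0 xc').
exists f; rewrite (fE x c) //; exists (0, 0), 1; split=> //=; by rewrite add0r mulr1z.
Qed.

End Characters.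

(** * Coinduced modules and enough injectives *)

Section Coinduced.
Variables (R : comPzRingType) (D : zmodType).

(** This cuts out Hom_Z(R, D) among all functions; R will act on the argument. *)
Definition coinduced_pred : {pred R -> D} :=
  fun f => `[< forall x y, f (x + y) = f x + f y >].

Lemma coinduced_zmod_closed : zmod_closed coinduced_pred.
Proof.
split=> [|f g /asboolP fD /asboolP gD]; first by apply/asboolP => x y; rewrite /= addr0.
apply/asboolP => x y; change (f (x + y) - g (x + y) = f x - g x + (f y - g y)).
by rewrite fD gD opprD addrACA.
Qed.

HB.instance Definition _ :=
  GRing.isZmodClosed.Build (R -> D) coinduced_pred coinduced_zmod_closed.

Record coinduced := Coinduced {coind_fun :> R -> D; coindP : coinduced_pred coind_fun}.
HB.instance Definition _ := [isSub for coind_fun].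
HB.instance Definition _ := [Choice of coinduced by <:].
HB.instance Definition _ := [SubChoice_isSubZmodule of coinduced by <:].

Lemma coindD (f : coinduced) x y : f (x + y) = f x + f y.
Proof. by have /asboolP := coindP f. Qed.

Lemma coind_inj (f g : coinduced) : f =1 g -> f = g.
Proof. by move=> fg; apply/val_inj/funext. Qed.

Definition coind_scale a (f : coinduced) : coinduced :=
  @Coinduced (fun x => f (x * a))
    (asboolT (fun x y => etrans (congr1 f (mulrDl x y a)) (coindD f _ _))).

Fact coind_scaleA a b f : coind_scale a (coind_scale b f) = coind_scale (a * b) f.
Proof. by apply: coind_inj => x /=; rewrite mulrA. Qed.
Fact coind_scale1 : left_id 1 coind_scale.
Proof. by move=> f; apply: coind_inj => x /=; rewrite mulr1. Qed.
Fact coind_scaleDr : right_distributive coind_scale +%R.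
Proof. by move=> a f g; apply: coind_inj. Qed.
Fact coind_scaleDl f : {morph coind_scale^~ f : a b / a + b}.
Proof. by move=> a b; apply: coind_inj => x /=; rewrite mulrDr coindD. Qed.
HB.instance Definition _ := GRing.Zmodule_isLmodule.Build R coinduced
  coind_scaleA coind_scale1 coind_scaleDr coind_scaleDl.

End Coinduced.

Section EnoughInjectives.
Variable R : comPzRingType.

(** By adjunction, linear maps B -> Hom_Z(R, D) are additive maps B -> D, through evaluation at 1.
    For D a power of Q / Z, extension is extension of one character per index t. *)
Lemma coinduced_injective (T : Type) : injective_module (coinduced R (T -> circle)).
Proof.
move=> A B f g f_inj.
have ext (t : T) : exists h : {additive B -> circle}, forall x, h (f x) = g x 1 t.
  pose G : set (B * circle) := [set p | exists x, f x = p.1 /\ g x 1 t = p.2].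
  have fG : functional_subgroup G.
    split; first by exists 0; rewrite !linear0.
      move=> _ _ _ _ [x /= [<- <-]] [y /= [<- <-]].
      by exists (x - y); rewrite !linearB.
    move=> y [x /= [fx <-]]; rewrite (f_inj x 0) ?linear0 //.
  by have [h hE] := character_extension fG; exists h => x; apply: hE; exists x.
pose h t := sval (cid (ext t)).
have hE t x : h t (f x) = g x 1 t by rewrite /h; case: cid.
have hD b : coinduced_pred (fun r t => h t (r *: b)).
  by apply/asboolP => r s; apply/funext => t; rewrite scalerDl raddfD.
pose H b : coinduced R (T -> circle) := Coinduced (hD b).
have H_linear : linear H.
  move=> a b c; apply: coind_inj => r; apply/funext => t.
  by rewrite /= scalerDr raddfD scalerA.
pose HL : {linear B -> coinduced R (T -> circle)} :=
  HB.pack H (GRing.isLinear.Build R B _ _ H H_linear).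
exists HL => x; apply: coind_inj => r; apply/funext => t /=.
by rewrite -linearZ hE linearZ /= mul1r.
Qed.

Variable M : lmodType R.

(** The index set consists of all characters of M, so that evaluating them embeds M. *)
Definition injective_cover : lmodType R :=
  coinduced R ({additive M -> circle} -> circle).

Fact to_cover_subproof (m : M) :
  coinduced_pred (fun (r : R) (chi : {additive M -> circle}) => chi (r *: m)).
Proof. by apply/asboolP => r s; apply/funext => chi; rewrite scalerDl raddfD. Qed.

Definition to_cover (m : M) : injective_cover := Coinduced (to_cover_subproof m).

Fact to_cover_linear : linear to_cover.
Proof.
move=> a m m'; apply: coind_inj => r; apply/funext => chi.
by rewrite /= scalerDr raddfD scalerA.
Qed.
HB.instance Definition _ := GRing.isLinear.Build R M _ _ to_cover to_cover_linear.

Lemma to_cover_inj : injective to_cover.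
Proof.
move=> m m' mm'; apply/eqP; rewrite -subr_eq0; apply/eqP; apply: contrapT.
move=> /character_separates[chi]; apply; rewrite raddfB.
have := congr1 (fun f : injective_cover => coind_fun f 1 chi) mm'.
by rewrite /= !scale1r => ->; rewrite subrr.
Qed.

End EnoughInjectives.

Section InjectiveResolution.
Variables (R : comPzRingType) (N : lmodType R).

Program Definition cover_image (M : lmodType R) : submodule (injective_cover M) :=
  @Submodule _ _ [set x | exists m, to_cover m = x] _ _ _.
Next Obligation. by move=> M; exists 0; rewrite linear0. Qed.
Next Obligation. by move=> M _ _ [m <-] [m' <-]; exists (m + m'); rewrite linearD. Qed.
Next Obligation. by move=> M a _ [m <-]; exists (a *: m); rewrite linearZ. Qed.

Fixpoint cosyzygy i : lmodType R :=
  if i is j.+1 then quot_module (cover_image (cosyzygy j)) else N.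

Definition resolution_diff i : {linear injective_cover (cosyzygy i) ->
  injective_cover (cosyzygy i.+1)} :=
  (@to_cover R (cosyzygy i.+1) \o quot_pi (cover_image (cosyzygy i)))%FUN.

Lemma resolution_diff_eq0 i x :
  resolution_diff i x = 0 <-> exists m : cosyzygy i, to_cover m = x.
Proof.
split=> [x0|xm].
  have /quot_piE :
    quot_pi (cover_image (cosyzygy i)) x = quot_pi (cover_image (cosyzygy i)) 0.
    by apply: to_cover_inj; rewrite !linear0.
  by rewrite subr0.
have -> : resolution_diff i x = to_cover (quot_pi (cover_image (cosyzygy i)) x) by [].
have /quot_piE -> : cover_image (cosyzygy i) (x - 0) by rewrite subr0.
by rewrite !linear0.
Qed.

Lemma injective_resolution_exists : exists E : injective_resolution N, True.
Proof.
suff ex i x : resolution_diff i.+1 x = 0 <-> exists y, resolution_diff i y = x.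
  by exists (@InjectiveResolution R N (fun i => injective_cover (cosyzygy i))
    (@to_cover R N) resolution_diff (fun i => @coinduced_injective R _)
    (@to_cover_inj R N) (@resolution_diff_eq0 0) ex).
split=> [/resolution_diff_eq0[m <-]|[y <-]].
  by have [y <-] := quot_pi_surj m; exists y.
by apply/resolution_diff_eq0; eexists.
Qed.

End InjectiveResolution.

(** * Local cohomology *)

Section Gamma.
Variable R : comPzRingType.
Implicit Types (a r : R) (s : seq R) (I K : ideal R) (i n t : nat).

Lemma ideal_powM I n a x : I a -> ideal_pow I n x -> ideal_pow I n.+1 (a * x).
Proof. by move=> Ia Ix; apply: sub_ideal_gen; exists a => //; exists x. Qed.

Lemma ideal_powX I n a : I a -> ideal_pow I n (a ^+ n).
Proof.
move=> Ia; elim: n => [|n IHn]; first exact: unit_idealE.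
by rewrite exprS; apply: ideal_powM.
Qed.

Lemma ideal_pow_le I K n :
  (forall a x, I a -> ideal_pow I n x -> K (a * x)) -> ideal_pow I n.+1 `<=` K.
Proof. by move=> IK; apply: ideal_gen_le => _ [a Ia [x Ix <-]]; apply: IK. Qed.

(** A product of n + t elements of (a) + (s) expands into terms with n factors a or t factors from
    (s). Splitting a factor x as a y + (x - a y) replaces K by its colon ideal by a, lowering n, or
    by x - a y, lowering t. *)
Lemma ideal_pow_adjoin K s a n t :
  K (a ^+ n) -> ideal_pow (ideal_gen [set` s]) t `<=` K ->
  ideal_pow (ideal_gen [set` a :: s]) (n + t) `<=` K.
Proof.
have K1 (L : ideal R) : L 1 -> forall J : set R, J `<=` L.
  by move=> L1 J x _; rewrite -[x]mulr1; apply: ideal_mull.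
move: {2}(n + t)%N (erefl (n + t)%N) => N; elim: N n t K => [|N IHN] n t K nt.
  by case: n nt => // nt Ka _; apply: K1.
case: n nt => [|n] nt Kan Ks; first exact: K1.
case: t nt Ks => [|t] nt Ks; first by apply: K1; apply: Ks; apply: unit_idealE.
rewrite nt; apply: ideal_pow_le => x w Gx Gw.
have [y sy] : adjoin (ideal_gen [set` s]) a x by move: Gx; rewrite !ideal_genE.
suff [aw yw] : K (a * w) /\ K ((x - a * y) * w).
  have -> : x * w = y * (a * w) + (x - a * y) * w by ring.
  by apply: submodD => //; apply: ideal_mull.
split.
  suff : ideal_pow (ideal_gen [set` a :: s]) N `<=` colon K a by move/(_ w Gw).
  have -> : (N = n + t.+1)%N by lia.
  apply: IHN; first by lia.
    by change (K (a * a ^+ n)); rewrite -exprS.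
  by move=> z /Ks Kz; apply: ideal_mull.
suff : ideal_pow (ideal_gen [set` a :: s]) N `<=` colon K (x - a * y) by move/(_ w Gw).
have -> : (N = n.+1 + t)%N by lia.
apply: IHN; first by lia.
  exact: ideal_mull.
by move=> z sz; apply: Ks; apply: ideal_powM.
Qed.

Lemma Gamma_torsion s (M : lmodType R) (m : M) :
  Gamma (ideal_gen [set` s]) M m <-> torsion s m.
Proof.
split=> [[n sm] a sa|sm].
  by exists n; apply/sm/ideal_powX/sub_ideal_gen.
suff [n sn] : exists n, ideal_pow (ideal_gen [set` s]) n `<=` ann_elt m by exists n.
elim: s sm => [_|a s IHs /torsion_cons[[k am] /IHs[n sn]]]; last first.
  by exists (k + n)%N; apply: ideal_pow_adjoin.
exists 1%N; apply: ideal_pow_le => a x; rewrite ideal_genE => /= -> _.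
by rewrite mul0r; apply: scale0r.
Qed.

End Gamma.

Section LocalCohomology.
Variables (R : comPzRingType) (noethR : noetherian R).
Implicit Types (a r : R) (s : seq R) (i n : nat).

Lemma subquot_eq0 (M : lmodType R) (N1 N2 : submodule M) r :
  (forall x : subquot N1 N2, r *: x = 0) <-> (forall y, N1 y -> N2 (r *: y)).
Proof.
have E (y : submod_type N1) :
    (r *: quot_pi (submod_in N1 N2) y = 0) <-> N2 (r *: (\val y : M)).
  rewrite -linearZ -(raddf0 (quot_pi (submod_in N1 N2))) quot_piE subr0.
  by change (N2 (\val (r *: y)) <-> N2 (r *: (\val y : M))); rewrite linearZ.
split=> [r0 y N1y|rN x].
  exact: (E (Sub y (asboolT N1y))).1 (r0 _).
by have [y <-] := quot_pi_surj x; apply/E/rN/submod_typeP.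
Qed.

(** The only access to the definition: existence of resolutions excludes the default branch, and
    both nonvanishing and annihilators are read on one resolution. *)
Lemma local_cohomologyE s (N : lmodType R) :
  exists E : injective_resolution N,
    (forall i, nonvanishing (ideal_gen [set` s]) N i <-> ~ vanishes E s i) /\
    (forall i r, ann (local_cohomology (ideal_gen [set` s]) i N) r <->
      forall e : res_obj E i, cocycle s e -> coboundary s (r *: e)).
Proof.
rewrite /nonvanishing /local_cohomology.
case: pselect => [exE|]; last by move=> /(_ (injective_resolution_exists N)).
set E := projT1 _; exists E.
have lcE i r : (forall x : cohomology_of (ideal_gen [set` s]) E i, r *: x = 0) <->
    forall e : res_obj E i, cocycle s e -> coboundary s (r *: e).
  rewrite subquot_eq0.
  have cocE e : cocycles (ideal_gen [set` s]) E i e <-> cocycle s e.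
    by split=> -[/Gamma_torsion].
  have cobE e : coboundaries (ideal_gen [set` s]) E i e <-> coboundary s e.
    case: (i) e => [|j] e //; split=> [[f /Gamma_torsion sf <-]|[f [/Gamma_torsion sf <-]]].
      by exists f.
    by exists f.
  by split=> rE e /cocE/rE/cobE.
split=> // i; split=> [[x x0] van|].
  apply: x0; rewrite -[x]scale1r; move: x; apply/lcE => e se.
  by rewrite scale1r; apply: van.
move=> nvan; apply: contrapT => nx; apply: nvan => e se; rewrite -[e]scale1r.
move: e se; apply/lcE => x; rewrite scale1r; apply: contrapT => x0.
by apply: nx; exists x.
Qed.

Section Bounds.
Variables (N : lmodType R) (s s0 : seq R).
Hypothesis s0N : forall a (m : N), a \in s0 -> a *: m = 0.
Let I := ideal_gen [set` s ++ s0].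

Lemma nonvanishing_le i : nonvanishing I N i -> (i <= size s)%N.
Proof.
have [E [Env _]] := local_cohomologyE (s ++ s0) N => /Env nv.
by rewrite leqNgt; apply/negP => /(vanishes_gt noethR s0N).
Qed.

Lemma nonvanishing_regular (m : N) : regular_anyorder N s ->
  ~ adjoins (zero_submod N) s m -> nonvanishing I N = [set size s].
Proof.
move=> s_reg sm; have [E [Env _]] := local_cohomologyE (s ++ s0) N.
apply/seteqP; split=> i; last first.
  by move=> ->; apply/Env => /(vanishes_top noethR s0N s_reg)/(_ m).
move=> Ii; apply/eqP; rewrite eqn_leq nonvanishing_le //= leqNgt; apply/negP.
by move/Env: Ii => + /(vanishes_lt noethR s0N s_reg).
Qed.

End Bounds.

Lemma ann_top_local_cohomology (N : lmodType R) s r :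
  ann (local_cohomology (ideal_gen [set` s]) (size s) N) r <->
  forall n (m : N), exists k,
    adjoins (zero_submod N) [seq a ^+ (n + k) | a <- s] ((\prod_(a <- s) a) ^+ k *: (r *: m)).
Proof.
have [E [_ ->]] := local_cohomologyE s N.
have nilN a (m : N) : a \in [::] -> a *: m = 0 by [].
by rewrite -(top_annihilator noethR E nilN) cats0.
Qed.

End LocalCohomology.

(** * Krull's height theorem *)

Section KrullHeight.
Variables (R : comPzRingType) (noethR : noetherian R).
Implicit Types (K L C P Q T V : ideal R) (v w x y z : R) (s : seq R).

Section Saturation.
Variables (P : ideal R) (primeP : prime_ideal P).

Let primePM x y : ~ P x -> ~ P y -> ~ P (x * y).
Proof. by move=> Px Py /(primeP.2 _ _)[]. Qed.

(* The contraction of the extension of K to the localization at P. *)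
Program Definition saturation K : ideal R :=
  @Submodule _ _ [set x | exists2 w, ~ P w & K (w * x)] _ _ _.
Next Obligation. by move=> K; exists 1; [apply: primeP.1|rewrite mulr0;
  apply: submod0]. Qed.
Next Obligation.
move=> K x y [w Pw Kwx] [w' Pw' Kwy]; exists (w' * w); first exact: primePM.
have -> : w' * w * (x + y) = w' * (w * x) + w * (w' * y) by ring.
by apply: submodD; apply: ideal_mull.
Qed.
Next Obligation.
by move=> K a x [w Pw Kwx]; exists w => //; rewrite mulrCA; apply: ideal_mull.
Qed.

Lemma sub_saturation K : K `<=` saturation K.
Proof. by move=> x Kx; exists 1; [apply: primeP.1|rewrite mul1r]. Qed.

Lemma saturationM K w x : ~ P w -> saturation K (w * x) -> saturation K x.
Proof. by move=> Pw [w' Pw' Kx]; exists (w' * w); [apply: primePM|rewrite -mulrA]. Qed.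

Lemma saturationS K L : K `<=` L -> saturation K `<=` saturation L.
Proof. by move=> KL x [w Pw /KL]; exists w. Qed.

(* If P is the only prime containing V up to localization at P, then R / V is
   locally artinian. *)
Lemma descending_stable V (I : nat -> ideal R) :
  (forall z, P z -> exists k, saturation V (z ^+ k)) ->
  (forall n, I n.+1 `<=` I n) ->
  exists n, I n `<=` saturation (submod_add (I n.+1) V).
Proof.
move=> VP Idec.
have Ile m n : (m <= n)%N -> I n `<=` I m.
  by move=> /subnK <-; elim: (n - m)%N => // k IHk; apply: subset_trans (Idec _) IHk.
pose stable C := exists n0, forall n, (n0 <= n)%N ->
  I n `<=` saturation (submod_add (I n.+1) C).
(* Noetherian induction: take C maximal among the ideals containing V modulo which the sequence is
   not stable. *)
suff [n In] : stable V by exists n; apply: In.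
apply: contrapT => nstabV.
have [C [nstabC VC Cmax]] := @noetherian_max R noethR (fun C => ~ stable C) V nstabV.
have addr (J C' : ideal R) : C' `<=` submod_add J C'.
  by move=> x Cx; exists 0; [apply: submod0|exists x; rewrite ?add0r].
have C1 : ~ saturation C 1.
  move=> [w Pw]; rewrite mulr1 => Cw; apply: nstabC; exists 0 => n _ x _.
  by exists w => //; apply: addr; apply: ideal_mulr.
(* An x outside C, locally at P, with maximal annihilator modulo C: this annihilator contains P, so
   (C + (x)) / C is locally simple. *)
have [D [[x Cx xD] _ Dmax]] := @noetherian_max R noethR
  (fun D => exists2 x, ~ saturation C x & D = colon (saturation C) x) _ (ex_intro2 _ _ 1 C1 erefl).
have Px z : P z -> saturation C (z * x).
  move=> Pz; have [k Czk] := VP z Pz.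
  have : saturation C (z ^+ k * x) by apply: ideal_mulr; apply: saturationS Czk.
  elim: k {Czk} => [|k IHk] Czx; first by case: Cx; rewrite expr0 mul1r in Czx.
  case: (pselect (saturation C (z ^+ k * x))) => [/IHk//|Czkx].
  suff : D z by rewrite xD mulrC.
  apply: (Dmax (colon (saturation C) (z ^+ k * x))); first by exists (z ^+ k * x).
    move=> r; rewrite xD => Cr; change (saturation C (z ^+ k * x * r)).
    by rewrite -mulrA; apply: ideal_mull.
  by change (saturation C (z ^+ k * x * z)); rewrite mulrAC -exprSr.
have [n0 stab'] : stable (adjoin C x).
  apply: contrapT => nstab; apply: Cx; apply: sub_saturation.
  by apply: (Cmax _ nstab); [apply: sub_adjoin|apply: adjoin_mem].
have split n y : (n0 <= n)%N -> I n y ->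
    exists w r, ~ P w /\ submod_add (I n.+1) C (w * y - r * x).
  move=> n0n /(stab' n n0n)[w Pw [a Ia [b [r Cbr] abE]]]; exists w, r; split=> //.
  by exists a => //; exists (b - x * r) => //; rewrite -abE (mulrC r) addrA.
(* By simplicity either every I n contains x modulo C, or from some n1 on the coefficient r must lie
   in P and r x vanishes. Both make C stable. *)
case: (pselect (forall n, saturation (submod_add (I n) C) x)) => [Ix|].
  apply: nstabC; exists n0 => n n0n y /(split n y n0n)[w [r [Pw Iwy]]].
  apply: (@saturationM _ w) => //; apply: (submod_subr (sub_saturation Iwy)).
  by apply: ideal_mull; apply: Ix.
move=> /existsNP[n1 nIx]; apply: nstabC; exists (maxn n0 n1) => n.
rewrite geq_max => /andP[n0n n1n] y Iy; have [w [r [Pw Iwy]]] := split n y n0n Iy.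
apply: (@saturationM _ w) => //; apply: (submod_subr (sub_saturation Iwy)).
apply: (saturationS (addr (I n.+1) C)); apply: Px; apply: contrapT => Pr; apply: nIx.
apply: (@saturationM _ r) => //; apply: sub_saturation.
have Iw : submod_add (I n1) C (w * y).
  by exists (w * y); [apply/ideal_mull/(Ile _ _ n1n)|exists 0;
    [apply: submod0|rewrite addr0]].
apply: (submod_subl _ Iw); case: Iwy => a Ia [c Cc acE]; exists a.
  exact: (Ile _ _ (leq_trans n1n (leqnSn n))).
by exists c.
Qed.

End Saturation.

Lemma proper_prime P Q : Q `<` P -> exists2 y, P y & ~ Q y.
Proof. by move=> [_ /existsNP[y /not_implyP[Py Qy]]]; exists y. Qed.

(* Krull's principal ideal theorem; the saturations of Q + (y^n), with y in P
   outside Q, play the role of the symbolic powers of P. *)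
Lemma krull_principal Q P (m : ideal R) v (primeP : prime_ideal P) (primem :
  prime_ideal m) :
  prime_ideal Q -> Q `<` P -> P `<=` m -> m v -> ~ P v ->
  ~ forall z, m z -> exists k, saturation primem (adjoin Q v) (z ^+ k).
Proof.
move=> primeQ QP Pm mv Pv mV; have [y Py Qy] := proper_prime QP.
have {}QP := properW QP.
pose I n := saturation primeP (adjoin Q (y ^+ n)).
have QI n : Q `<=` I n by apply: subset_trans (@sub_adjoin _ _ _ _) (@sub_saturation _ _ _).
have Idec n : I n.+1 `<=` I n.
  apply: saturationS; apply: adjoin_le => [|x]; first exact: sub_adjoin.
  rewrite exprS -scalerA; exact/submodZ/adjoin_scale.
have [n In] := descending_stable mV Idec.
(* Locally at m, I n = I n.+1 + v I n: the cofactor r stays in I n because v is outside P. *)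
have step x : I n x -> exists w r, [/\ ~ m w, I n r & I n.+1 (w * x - v * r)].
  move=> Ix; have [w mw [a Ia [b [r Qbr] abE]]] := In x Ix; exists w, r.
  have Iwr : I n.+1 (w * x - v * r) by rewrite -abE -addrA; apply: submodD => //; apply: QI.
  split=> //; apply: (@saturationM _ primeP _ v) => //.
  by apply: (submod_subl (Idec _ _ Iwr)); apply: ideal_mull.
have steps j x : I n x -> exists w r, [/\ ~ m w, I n r & I n.+1 (w * x - v ^+ j * r)].
  move=> Ix; elim: j => [|j [w [r [mw Ir Iwr]]]].
    by exists 1, x; rewrite expr0 subrr; split=> //; [apply: primem.1|apply: submod0].
  have [w' [r' [mw' Ir' Iwr']]] := step r Ir; exists (w' * w), r'; split=> //.
    by move=> /(primem.2 _ _)[].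
  have -> : w' * w * x - v ^+ j.+1 * r' = w' * (w * x - v ^+ j * r) + v ^+ j * (w' * r - v * r').
    by rewrite exprSr; ring.
  by apply: submodD; apply: ideal_mull.
(* Artin-Rees takes the place of Nakayama's lemma: high powers of v lie in B, so y^n does locally,
   whence (w - v t) y^n lies in I n.+1 with w - v t outside m. *)
have Iy : I n.+1 (y ^+ n).
  have Iyn : I n (y ^+ n) by apply/sub_saturation/adjoin_mem.
  have [||B [CB BA Bv]] := @artin_rees R noethR (adjoin (I n.+1) (y ^+ n))
      (adjoin (I n.+1) (v * y ^+ n)) [:: v].
  - apply: adjoin_le => [|x]; first exact: sub_adjoin.
    by rewrite -scalerA; apply/submodZ/adjoin_scale.
  - move=> _ x /[!inE]/eqP-> [r Ixr]; exists r.
    by rewrite -[(v * _) *: _]mulrA -mulrBr; apply: ideal_mull.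
  have [k Bk] := Bv v (mem_head _ _); have [w [r [mw Ir Iwr]]] := steps k _ Iyn.
  have Bwy : B (w * y ^+ n).
    by apply: (submod_subr (CB _ (sub_adjoin _ Iwr))); apply: ideal_mulr.
  have [t Iwt] := BA _ Bwy (ideal_mull w (adjoin_mem _ _)).
  have {}Iwt : I n.+1 ((w - v * t) * y ^+ n).
    by move: Iwt; congr (submod_set _ _); rewrite /GRing.scale /=; ring.
  apply: saturationM Iwt => /Pm mwt; apply: mw; apply: (submod_subr mwt).
  exact: ideal_mulr.
have [s Ps [t Qst]] := Iy; have : Q (y ^+ n * (s - y * t)).
  by move: Qst; congr (submod_set _ _); rewrite /GRing.scale /= exprS; ring.
case/primeQ.2 => [/(prime_idealX primeQ)//|/QP Pst].
by apply: Ps; apply: (submod_subr Pst); apply: ideal_mulr.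
Qed.

(** If v is outside P, [krull_principal] gives z in m with no power in Q + (v), even locally at m.
    An ideal above Q + (v) maximal for avoiding all w z^k with w outside m is prime. *)
Lemma prime_between Q P (m : ideal R) v :
  prime_ideal Q -> prime_ideal P -> prime_ideal m -> Q `<` P -> P `<` m -> m v ->
  exists T, [/\ prime_ideal T, Q `<` T, T `<` m & T v].
Proof.
move=> primeQ primeP primem QP Pm mv.
case: (pselect (P v)) => Pv; first by exists P.
apply: contrapT => nT.
apply: (krull_principal (primem := primem) primeP primeQ QP (properW Pm) mv Pv) => z mz.
apply: contrapT => nk; apply: nT.
pose F L := forall k w, ~ m w -> ~ L (w * z ^+ k).
have [|L [FL QL Lmax]] := @noetherian_max R noethR F (adjoin Q v).
  by move=> k w mw Qwz; apply: nk; exists k, w.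
have Lv : L v by apply/QL/adjoin_mem.
have L1 : ~ L 1 by have := FL 0 1 primem.1; rewrite expr0 mulr1.
have Lm : L `<=` m.
  by move=> x Lx; apply: contrapT => mx; apply: (FL 0 x mx); rewrite expr0 mulr1.
exists L; split=> //; last first.
- by split=> // /(_ z mz) Lz; apply: (FL 1 1 primem.1); rewrite mul1r.
- split; first exact: subset_trans (@sub_adjoin _ _ _ _) QL.
  by move=> /(_ v Lv)/(properW QP).
split=> // a b Lab.
have adj c : ~ L c -> exists k w, ~ m w /\ adjoin L c (w * z ^+ k).
  move=> Lc; apply: contrapT => nkw; apply: Lc; apply: (Lmax (adjoin L c)).
  - by move=> k w mw Lwz; apply: nkw; exists k, w.
  - exact: sub_adjoin.
  - exact: adjoin_mem.
case: (pselect (L a)) => La; [by left|case: (pselect (L b)) => Lb; [by right|exfalso]].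
have [k [w [mw [r Lr]]]] := adj a La; have [k' [w' [mw' [r' Lr']]]] := adj b Lb.
apply: (FL (k + k')%N (w * w')); first by move=> /primem.2[].
have -> : w * w' * z ^+ (k + k') = w' * z ^+ k' * (w * z ^+ k - a *: r) +
    a * r * (w' * z ^+ k' - b *: r') + r * r' * (a * b).
  by rewrite /GRing.scale /= exprD; ring.
by apply: submodD; [apply: submodD|]; apply: ideal_mull.
Qed.

Definition prime_chain (P : nat -> ideal R) n :=
  (forall i, (i <= n)%N -> prime_ideal (P i)) /\ (forall i, (i < n)%N -> P i `<` P i.+1).

(** Each use of [prime_between] moves v one place down the chain, from the top to index 1. *)
Lemma prime_chain_through (P : nat -> ideal R) n v : prime_chain P n.+1 -> P n.+1 v ->
  exists P' : nat ->
    ideal R, [/\ prime_chain P' n.+1, P' 0 = P 0, P' n.+1 = P n.+1 & P' 1 v].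
Proof.
elim: n P => [|n IHn] P [Pprime Pstrict] Pv; first by exists P.
have [||||||T [primeT PT TP Tv]] := @prime_between (P n) (P n.+1) (P n.+2) v.
all: rewrite ?leqnn //.
- by apply: Pprime; rewrite ltnW.
- by apply: Pprime.
- by apply: Pprime.
- by apply: Pstrict.
- by apply: Pstrict.
have [||P' [[P'prime P'strict] P'0 P'n P'v]] := IHn (fun i => if i == n.+1 then T else P i).
- split=> i.
    case: eqP => // /eqP i_n; rewrite leq_eqVlt (negPf i_n) /= => /ltnW i_lt.
    by apply: Pprime; apply: leq_trans i_lt _.
  rewrite ltnS => i_n; rewrite (ltn_eqF (leq_ltn_trans i_n (ltnSn n))) eqSS.
  case: eqP => [->//|/eqP ni]; apply: Pstrict.
  by rewrite ltnS (leq_trans i_n).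
- by rewrite eqxx.
rewrite eqxx in P'n.
exists (fun i => if i == n.+2 then P n.+2 else P' i); split=> //; last by rewrite eqxx.
split=> i.
  case: eqP => [->|/eqP i_n]; first by move=> _; apply: Pprime.
  by rewrite leq_eqVlt (negPf i_n) /=; apply: P'prime.
rewrite ltnS => i_n; rewrite (ltn_eqF (leq_ltn_trans i_n (ltnSn _))) eqSS.
case: eqP => [->|/eqP ni]; first by rewrite P'n.
by apply: P'strict; rewrite ltn_neqAle ni.
Qed.

Lemma prime_chain_le (P : nat -> ideal R) n i j : prime_chain P n -> (i <= j <= n)%N ->
  P i `<=` P j.
Proof.
move=> [_ Pstrict] /andP[/subnKC <-]; elim: (j - i)%N => [|k IHk];
  first by rewrite addn0 => _ x.
rewrite addnS => kn; apply: subset_trans (IHk (ltnW kn)) _.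
exact: properW (Pstrict _ kn).
Qed.

(** Working over P 0 makes the induction close: once a lies in P' 1, dropping P' 0 leaves a chain
    over P' 1 whose top is minimal over P' 1 and the other generators. *)
Lemma krull_height s n (P : nat -> ideal R) : prime_chain P n -> adjoins (P 0) s `<=` P n ->
  (forall T, prime_ideal T -> adjoins (P 0) s `<=` T -> T `<=` P n -> P n `<=` T) ->
  (n <= size s)%N.
Proof.
elim: s n P => [|a s IHs] [|n] P // Pchain sP Pmin.
  have [_ Pstrict] := Pchain; have [_ []] := Pstrict 0 isT.
  apply: (@subset_trans _ (P n.+1)); last exact: Pmin (Pchain.1 0 isT) (@subset_refl _ _) _.
  by apply: (prime_chain_le Pchain); rewrite leqnn.
have [P' [P'chain P'0 P'n P'a]] :=
  prime_chain_through Pchain (sP _ (adjoins_mem _ (mem_head _ _))).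
have P01 : P 0 `<=` P' 1 by rewrite -P'0; apply: (prime_chain_le P'chain).
apply: (IHs n (fun i => P' i.+1)).
- by split=> i i_n; [apply: P'chain.1|apply: P'chain.2].
- apply: adjoins_ideal_le => [|b bs]; first by apply: (prime_chain_le P'chain);
  rewrite leqnn.
  by rewrite P'n; apply/sP/adjoins_mem; rewrite inE bs orbT.
move=> T primeT sT; rewrite P'n; apply: Pmin => //.
apply: adjoins_ideal_le => [|b];
  first exact: subset_trans P01 (subset_trans (@sub_adjoins _ _ _ _) sT).
by rewrite inE => /predU1P[->|bs]; apply: sT; [apply: sub_adjoins|apply: adjoins_mem].
Qed.

Lemma krull_height_gen s n (P : nat -> ideal R) : prime_ideal (ideal_gen [set` s]) ->
  prime_chain P n -> P n `<=` ideal_gen [set` s] -> (n <= size s)%N.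
Proof.
set G := ideal_gen _ => primeG Pchain PG.
have sP (Q : ideal R) : Q `<=` G -> adjoins Q s `<=` G.
  by move=> QG; apply: adjoins_ideal_le => // a sa; apply: sub_ideal_gen.
have Gs (Q T : ideal R) : adjoins Q s `<=` T -> G `<=` T.
  by move=> QT; apply: ideal_gen_le => a /= sa; apply/QT/adjoins_mem.
have P0G : P 0 `<=` G by apply: subset_trans PG; apply: (prime_chain_le Pchain);
  rewrite leqnn.
case: (pselect (G `<=` P n)) => GP.
  apply: (krull_height Pchain) => [|T _ /Gs GT _]; last exact: subset_trans PG GT.
  exact: subset_trans (sP _ P0G) GP.
(* A chain ending strictly below G is lengthened by G itself. *)
apply: ltnW; apply: (@krull_height s n.+1 (fun i => if i == n.+1 then G else P i)).
- split=> i.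
    case: eqP => [//|/eqP i_n]; rewrite leq_eqVlt (negPf i_n) /=; exact: Pchain.1.
  rewrite ltnS => i_n; rewrite (ltn_eqF (leq_ltn_trans i_n (ltnSn _))) eqSS.
  case: eqP => [->|/eqP ni]; first by split.
  by apply: Pchain.2; rewrite ltn_neqAle ni.
- by rewrite /= eqxx; apply: sP.
by move=> T _ /= /Gs; rewrite eqxx.
Qed.

End KrullHeight.

(** * Dimension, support and quotient rings *)

Lemma ebar_le m n : (ebar m <= ebar n)%O = (m <= n)%N.
Proof. by rewrite /ebar lee_fin lez_nat. Qed.

Lemma esupE (B : set (\bar int)) b y : B b -> supremums B y -> esup B = y.
Proof.
move=> Bb By; rewrite /esup /supremum ifF; last by apply/eqP => B0; rewrite B0 in Bb.
by apply: xget_unique => // z Bz; apply: is_subset1_supremums Bz By.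
Qed.

Lemma einfE (B : set (\bar int)) b y : B b -> infimums B y -> einf B = y.
Proof.
move=> Bb By; rewrite /einf /infimum ifF; last by apply/eqP => B0; rewrite B0 in Bb.
by apply: xget_unique => // z Bz; apply: is_subset1_infimums Bz By.
Qed.

Lemma esup_max (A : set nat) n :
  A n -> (forall k, A k -> (k <= n)%N) -> esup [set ebar i | i in A] = ebar n.
Proof.
move=> An Amax; apply: (@esupE _ (ebar n)); first by exists n.
split; first by move=> _ [k /Amax kn <-]; rewrite ebar_le.
by move=> y; apply; exists n.
Qed.

Lemma einf_min (A : set nat) n :
  A n -> (forall k, A k -> (n <= k)%N) -> einf [set ebar i | i in A] = ebar n.
Proof.
move=> An Amin; apply: (@einfE _ (ebar n)); first by exists n.
split; first by move=> _ [k /Amin nk <-]; rewrite ebar_le.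
by move=> y; apply; exists n.
Qed.

Lemma nat_max (A : set nat) k m : A k -> (forall i, A i -> (i <= m)%N) ->
  exists2 n, A n & forall i, A i -> (i <= n)%N.
Proof.
move=> Ak Am; have exA : exists i, `[< A i >] by exists k; apply/asboolP.
have [n /asboolP An nmax] := ex_maxnP exA (fun i Ai => Am i (asboolW Ai)).
by exists n => // i Ai; apply/nmax/asboolP.
Qed.

Lemma esup_nat (A : set nat) k : A k ->
  (exists n, [/\ A n, forall i, A i -> (i <= n)%N & esup [set ebar i | i in A] = ebar n]) \/
  (forall m, exists2 i, A i & (m <= i)%N) /\ esup [set ebar i | i in A] = +oo%E.
Proof.
move=> Ak; case: (pselect (exists m, forall i, A i -> (i <= m)%N)) => [[m Am]|nbounded].
  by left; have [n An nmax] := nat_max Ak Am; exists n; split=> //; apply: esup_max.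
have unbounded m : exists2 i, A i & (m <= i)%N.
  apply: contrapT => nm; apply: nbounded; exists m => i Ai.
  by rewrite leqNgt; apply/negP => /ltnW mi; apply: nm; exists i.
right; split=> //; apply: (@esupE _ (ebar k)); first by exists k.
split=> [y _|[r||]] /=; rewrite ?leey // => ub.
  have [i Ai ri] := unbounded `|r|.+1%N; have := ub (ebar i).
  by rewrite /ebar lee_fin => /(_ (ex_intro2 _ _ i Ai erefl)); lia.
by have := ub (ebar k) (ex_intro2 _ _ k Ak erefl).
Qed.

Section Chains.
Variable R : comPzRingType.
Implicit Types (C : set (ideal R)) (P Q : ideal R) (n : nat).

Definition chain_in C n := exists P : nat -> ideal R,
  (forall i, (i <= n)%N -> C (P i)) /\ (forall i, (i < n)%N -> P i `<` P i.+1).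

Lemma chain_in0 C P : C P -> chain_in C 0.
Proof. by move=> CP; exists (fun=> P); split. Qed.

Lemma chain_sup_max C n :
  chain_in C n -> (forall k, chain_in C k -> (k <= n)%N) -> chain_sup C = ebar n.
Proof. exact: esup_max. Qed.

Lemma chain_sup_le C n k : chain_sup C = ebar n -> chain_in C k -> (k <= n)%N.
Proof.
move=> supC Ck; have [[m [_ mC mE]]|[_ /(etrans (esym supC))//]] := esup_nat Ck.
by have := etrans (esym supC) mE => -[->]; apply: mC.
Qed.

Lemma chain_in_trunc C n k : (k <= n)%N -> chain_in C n -> chain_in C k.
Proof.
by move=> kn [P [PC Pstrict]]; exists P; split=> i ik; [apply: PC|apply: Pstrict];
  apply: leq_trans ik kn.
Qed.

(** P is among the primes over which the infimum is taken, so chains below P reach length n. *)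
Lemma height_chain P n : prime_ideal P -> height P = ebar n ->
  chain_in [set Q | prime_ideal Q /\ Q `<=` P] n.
Proof.
move=> primeP hP; pose below Q := [set Q' | prime_ideal Q' /\ Q' `<=` Q].
have c0 Q : prime_ideal Q -> chain_in (below Q) 0.
  by move=> primeQ; apply: (@chain_in0 _ Q); split.
have [[k [Pk _ kE]]|[Pub _]] := esup_nat (c0 P primeP); last first.
  by have [i Pi ni] := Pub n; apply: chain_in_trunc Pi.
pose B := [set prime_height Q | Q in [set Q | prime_ideal Q /\ P `<=` Q]].
have Bk : B (ebar k) by exists P => //; split=> //; apply: subset_refl.
have exB : exists j, `[< B (ebar j) >] by exists k; apply/asboolP.
case: (ex_minnP exB) => j /asboolP Bj jmin.
have jB : infimums B (ebar j).
  split=> [_ [Q [primeQ PQ] <-]|y]; last by apply.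
  have [[i [_ _ iE]]|[_ iE]] := esup_nat (c0 Q primeQ); last first.
    by rewrite [prime_height Q]iE leey.
  rewrite [prime_height Q]iE ebar_le; apply: jmin; apply/asboolP.
  by rewrite -[ebar i]iE; exists Q.
have nj : (n <= j)%N by rewrite -ebar_le -hP [height P](einfE Bk jB).
by apply: chain_in_trunc Pk; apply: leq_trans nj _; apply: jmin; apply/asboolP.
Qed.

End Chains.

Section Modules.
Variable R : comPzRingType.
Implicit Types (P Q K : ideal R) (M : lmodType R).

Lemma quot_scale_pi K (a x : R) : a *: quot_pi K x = quot_pi K (a * x).
Proof. by rewrite -linearZ. Qed.

Lemma quot_pi_eq0 K (x : R) : quot_pi K x = 0 <-> K x.
Proof. by rewrite -(raddf0 (quot_pi K)) quot_piE subr0. Qed.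

Lemma Supp_quot K : Supp (quot_module K) = [set P | prime_ideal P /\ K `<=` P].
Proof.
apply/seteqP; split=> P [primeP]; last first.
  move=> KP; split=> //; exists (quot_pi K 1) => a Pa.
  by rewrite quot_scale_pi mulr1 => /quot_pi_eq0/KP.
move=> [x xP]; split=> // a Ka; apply: contrapT => /xP; apply.
have [y <-] := quot_pi_surj x; rewrite quot_scale_pi; apply/quot_pi_eq0.
exact: ideal_mulr.
Qed.

Lemma Supp_regular : Supp (R^o : lmodType R) = prime_ideal (R := R).
Proof.
apply/seteqP; split=> P; first by case.
move=> primeP; split=> //; exists 1 => a Pa; rewrite /GRing.scale /= mulr1 => a0.
by apply: Pa; rewrite a0; apply: submod0.
Qed.

Lemma cd_set1 I M n : nonvanishing I M = [set n] -> cd I M = ebar n.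
Proof. by move=> nvE; apply: esup_max; rewrite nvE // => k ->. Qed.

Lemma depth_set1 I M n : nonvanishing I M = [set n] -> depth I M = ebar n.
Proof. by move=> nvE; apply: einf_min; rewrite nvE // => k ->. Qed.

Lemma cd_max I M n :
  nonvanishing I M n -> (forall i, nonvanishing I M i -> (i <= n)%N) -> cd I M = ebar n.
Proof. exact: esup_max. Qed.

End Modules.

Section QuotientRing.
Variables (S : comPzRingType) (J : ideal S).
Implicit Types (A B P : ideal S) (Q : ideal (quot_ring J)).

Lemma ring_pi0 : ring_pi J 0 = 0.
Proof. exact: (raddf0 (quot_pi J)). Qed.

Program Definition pullback Q : ideal S :=
  @Submodule _ _ [set x : S | Q (ring_pi J x)] _ _ _.
Next Obligation. by move=> Q; change (Q (ring_pi J 0)); rewrite ring_pi0;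
  apply: submod0. Qed.
Next Obligation.
by move=> Q x y Qx Qy; change (Q (ring_pi J (x + y))); rewrite ring_piD; apply: submodD.
Qed.
Next Obligation.
by move=> Q a x Qx; change (Q (ring_pi J (a * x))); rewrite ring_piM; apply: ideal_mull.
Qed.

Lemma quot_idealE A x : J `<=` A -> quot_ideal J A (ring_pi J x) <-> A x.
Proof.
move=> JA; split=> [[y Ay /ring_piE/JA yx]|]; last by exists x.
exact: submod_subl yx Ay.
Qed.

Lemma quot_ideal_le A B : J `<=` B ->
  quot_ideal J A `<=` quot_ideal J B <-> A `<=` B.
Proof.
move=> JB; split=> AB; last by move=> _ [x /AB Bx <-]; exists x.
by move=> x Ax; apply/(quot_idealE _ JB)/AB; exists x.
Qed.

Lemma sub_pullback Q : J `<=` pullback Q.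
Proof.
move=> x Jx; change (Q (ring_pi J x)).
have /ring_piE -> : J (x - 0) by rewrite subr0.
by rewrite ring_pi0; apply: submod0.
Qed.

Lemma pullback_le Q Q' : Q `<=` Q' <-> pullback Q `<=` pullback Q'.
Proof.
split=> QQ' x; first exact: QQ'.
by have [y <-] := ring_pi_surj x; apply: QQ'.
Qed.

Lemma pullback_proper Q Q' : Q `<` Q' -> pullback Q `<` pullback Q'.
Proof. by move=> [QQ' Q'Q]; split; [apply/pullback_le|move/pullback_le]. Qed.

Lemma prime_pullback Q : prime_ideal Q -> prime_ideal (pullback Q).
Proof.
move=> [Q1 QM]; split=> // x y; change (Q (ring_pi J (x * y)) ->
  Q (ring_pi J x) \/ Q (ring_pi J y)).
by rewrite ring_piM; apply: QM.
Qed.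

Lemma prime_quot_ideal A : J `<=` A -> prime_ideal A -> prime_ideal (quot_ideal J A).
Proof.
move=> JA [A1 AM]; split=> [/(quot_idealE _ JA)//|a b].
have [x <-] := ring_pi_surj a; have [y <-] := ring_pi_surj b.
by rewrite -[ring_pi J x * _]ring_piM !quot_idealE //; apply: AM.
Qed.

Lemma noetherian_quot : noetherian S -> noetherian (quot_ring J).
Proof.
move=> noethS Q; have [s sE] := noethS (pullback Q).
exists [seq ring_pi J a | a <- s]; apply: submodP => z; split; last first.
  apply: ideal_gen_le => _ /= /mapP[a sa ->].
  by change (pullback Q a); rewrite sE; apply: sub_ideal_gen.
have [x <-] := ring_pi_surj z => Qx; have : pullback Q x by [].
rewrite sE => sx; suff /(_ x sx) : ideal_gen [set` s] `<=`
  pullback (ideal_gen [set` [seq ring_pi J a | a <- s]]) by [].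
by apply: ideal_gen_le => a /= sa; apply: sub_ideal_gen; apply: map_f.
Qed.

End QuotientRing.

(** * Prime generators *)

Section Transfer.
Variables (S R : comPzRingType) (pi : S -> R) (N : lmodType R) (f : S -> N).
Hypothesis fB : {morph f : x y / x - y}.
Hypothesis fM : forall a x, f (a * x) = pi a *: f x.
Hypothesis f_surj : forall z, exists x, f x = z.
Implicit Types (L : submodule N) (K : ideal S) (s : seq S).

Lemma transfer_adjoin L K a : (forall x, L (f x) <-> K x) ->
  forall x, adjoin L (pi a) (f x) <-> adjoin K a x.
Proof.
move=> LK x; split=> [[z]|[y /LK Kxy]]; last by exists (f y); rewrite -fM -fB.
by have [y <-] := f_surj z; rewrite -fM -fB => /LK Kxy; exists y.
Qed.

Lemma transfer_adjoins L K s : (forall x, L (f x) <-> K x) ->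
  forall x, adjoins L [seq pi a | a <- s] (f x) <-> adjoins K s x.
Proof. by move=> LK; elim: s => [|a s IHs] //=; apply: transfer_adjoin. Qed.

Lemma transfer_regseq L K s : (forall x, L (f x) <-> K x) ->
  regseq K s -> regseq L [seq pi a | a <- s].
Proof.
elim: s L K => //= a s IHs L K LK [Ka Ks]; split; last exact: IHs (transfer_adjoin a LK) Ks.
by move=> z; have [x <-] := f_surj z; rewrite -fM => /LK/Ka/LK.
Qed.

End Transfer.

Section PrimeGenerators.
Variables (S : comPzRingType) (noethS : noetherian S) (d : nat) (U : {fset S}).
Implicit Types (V W : {fset S}) (s : seq S).

Definition fgen V : ideal S := ideal_gen [set` V].

Hypotheses (dimS : ring_dim S = ebar d) (heightU : height (fgen U) = ebar d).
Hypothesis cardU : (#|` U| <= d)%N.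
Hypothesis primeU : forall V, (V `<=` U)%fset -> prime_ideal (fgen V).

Lemma fgen_mem V x : x \in V -> fgen V x.
Proof. by move=> Vx; apply: sub_ideal_gen. Qed.

Lemma fgen_le V (K : ideal S) : (forall x, x \in V -> K x) -> fgen V `<=` K.
Proof. by move=> VK; apply: ideal_gen_le => x /VK. Qed.

Lemma fgenS V W : (V `<=` W)%fset -> fgen V `<=` fgen W.
Proof. by move=> /fsubsetP VW; apply: fgen_le => x /VW/fgen_mem. Qed.

Lemma adjoin_fgen V a : adjoin (fgen V) a = fgen (a |` V)%fset.
Proof.
apply: submodP => x; split.
  apply: adjoin_le => [|y]; first exact/fgenS/fsubsetU1.
  by apply: ideal_mulr; apply: fgen_mem; rewrite !inE eqxx.
move: x; apply: fgen_le => b; rewrite !inE => /predU1P[->|Vb]; first exact: adjoin_mem.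
exact/sub_adjoin/fgen_mem.
Qed.

(** The height of (U) provides a chain of length d below (U), and Krull's theorem for the prime (V)
    bounds it by |V|. *)
Lemma card_generating V : (V `<=` U)%fset -> fgen U `<=` fgen V -> (d <= #|` V|)%N.
Proof.
move=> VU UV; have [P [PU Pstrict]] := height_chain (primeU (fsubset_refl U)) heightU.
apply: (@krull_height_gen S noethS V d P (primeU VU)).
  by split=> // i /PU[].
by apply: subset_trans UV; apply: (PU d (leqnn d)).2.
Qed.

Lemma card_prime_generators : #|` U| = d.
Proof. by apply/eqP; rewrite eqn_leq cardU; apply: card_generating. Qed.

Lemma fgen_notin V x : (V `<=` U)%fset -> x \in U -> x \notin V -> ~ fgen V x.
Proof.
move=> VU Ux Vx fVx; have : (d <= #|` (U `\ x)%fset|)%N.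
  apply: card_generating; first exact: fsubD1set.
  apply: fgen_le => y Uy; case: (eqVneq y x) => [->|yx]; last by apply: fgen_mem;
    rewrite !inE yx.
  by apply: fgenS fVx; rewrite fsubsetD1 VU.
by rewrite -card_prime_generators (cardfsD1 x U) Ux ltnn.
Qed.

Lemma fgen_notin_proper V x : (V `<=` U)%fset -> x \in U -> x \notin V ->
  fgen V `<` fgen (x |` V)%fset.
Proof.
move=> VU Ux Vx; split; first exact/fgenS/fsubsetU1.
by move=> /(_ x (fgen_mem (fset1U1 _ _))); apply: fgen_notin.
Qed.

(** An element outside the prime (V) is regular modulo it, and adjoining it gives a prime of the
    same kind. *)
Lemma regseq_fgen V s : (V `<=` U)%fset -> uniq s -> {subset s <= U} ->
  (forall x, x \in s -> x \notin V) -> regseq (fgen V) s.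
Proof.
elim: s V => //= a s IHs V VU /andP[as_ us] sU sV.
have Ua : a \in U by apply: sU; rewrite mem_head.
split.
  move=> x /(primeU VU).2[] // /fgen_notin Va; exfalso; apply: Va => //.
  by apply: sV; rewrite mem_head.
rewrite adjoin_fgen; apply: IHs => // [|x xs|x xs].
- by rewrite fsubUset fsub1set Ua.
- by apply: sU; rewrite inE xs orbT.
rewrite !inE negb_or sV ?inE ?xs ?orbT // andbT; apply: contraNneq as_ => <-; exact: xs.
Qed.

Definition above V : set (ideal S) := [set P | prime_ideal P /\ fgen V `<=` P].

Lemma chain_above_cons V x n : (V `<=` U)%fset -> x \in U -> x \notin V ->
  chain_in (above (x |` V)%fset) n -> chain_in (above V) n.+1.
Proof.
move=> VU Ux Vx [P [PV Pstrict]]; have [VxV xVV] := fgen_notin_proper VU Ux Vx.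
exists (fun i => if i is j.+1 then P j else fgen V); split=> [[|i] ile|[|i] ilt] /=.
- by split; [apply: primeU|].
- by have [primeP VP] := PV i ile; split=> //; apply: subset_trans VxV VP.
- have [_ VP] := PV 0 isT; split; first exact: subset_trans VxV VP.
  by move=> PV0; apply: xVV; apply: subset_trans VP PV0.
- exact: Pstrict.
Qed.

Lemma chain_above_le V n : (V `<=` U)%fset -> chain_in (above V) n -> (n + #|` V| <= d)%N.
Proof.
move=> VU Vn; apply: (chain_sup_le dimS).
suff [P [PV Pstrict]] : chain_in (above fset0) (n + #|` V|).
  by exists P; split=> // i /PV[].
move cV: #|` V| => k; elim: k n V cV VU Vn => [|k IHk] n V cV VU Vn.
  by rewrite addn0 -(cardfs0_eq cV).
have [x Vx] : exists x, x \in V by apply/fset0Pn; rewrite -cardfs_gt0 cV.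
have Vxx : (V `\ x `<=` U)%fset by apply: fsubset_trans VU; apply: fsubD1set.
rewrite addnS -addSn; apply: (IHk n.+1 (V `\ x)%fset) => //.
  by move: cV; rewrite (cardfsD1 x V) Vx => -[].
apply: (chain_above_cons (x := x)) => //; first exact: (fsubsetP VU).
  by rewrite !inE eqxx.
by rewrite fsetD1K.
Qed.

Lemma chain_above_exists V : (V `<=` U)%fset -> chain_in (above V) (d - #|` V|).
Proof.
move: {2}(d - #|` V|)%N (erefl (d - #|` V|)%N) => k; elim: k V => [|k IHk] V dV VU.
  by rewrite dV; apply: (@chain_in0 _ _ (fgen V)); split=> //; apply: primeU.
have /fsubsetPn[x Ux Vx] : ~~ (U `<=` V)%fset.
  by apply/negP => /fsubset_leq_card; rewrite card_prime_generators; lia.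
have cV : #|` (x |` V)%fset| = #|` V|.+1 by rewrite cardfsU1 Vx.
rewrite dV; apply: (chain_above_cons VU Ux Vx).
have <- : (d - #|` (x |` V)%fset|)%N = k by rewrite cV; lia.
by apply: IHk; [rewrite cV; lia|rewrite fsubUset fsub1set Ux].
Qed.

Section Quotient.
Variable J : ideal S.
Notation R := (quot_ring J).
Notation pi := (ring_pi J).
Implicit Types (Q : ideal R).

Lemma ring_piX a n : pi (a ^+ n) = pi a ^+ n.
Proof. by elim: n => // n IHn; rewrite !exprS -IHn [LHS]ring_piM. Qed.

Lemma ring_piB : {morph pi : x y / x - y}.
Proof. exact: (raddfB (quot_pi J)). Qed.

Lemma chain_quot V n : J `<=` fgen V ->
  chain_in [set Q | prime_ideal Q /\ quot_ideal J (fgen V) `<=` Q] n <->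
  chain_in (above V) n.
Proof.
move=> JV; split=> [[Q [Qprime Qstrict]]|[P [Pprime Pstrict]]].
  exists (fun i => pullback (Q i)); split=> i ile; last exact/pullback_proper/Qstrict.
  have [primeQ VQ] := Qprime i ile; split; first exact: prime_pullback.
  by move=> x Vx; apply: VQ; exists x.
have JP i : (i <= n)%N -> J `<=` P i by move=> /Pprime[_]; apply: subset_trans.
exists (fun i => quot_ideal J (P i)); split=> i ile.
  have [primeP VP] := Pprime i ile; split; first exact/prime_quot_ideal/primeP/JP.
  by apply/quot_ideal_le => //; apply: JP.
have [PP' P'P] := Pstrict i ile; split; first by apply/quot_ideal_le => //; apply: JP.
by move/quot_ideal_le => P'P'; apply: P'P; apply: P'P'; apply: JP; apply: ltnW.
Qed.

Lemma mod_dim_quot V : (V `<=` U)%fset -> J `<=` fgen V ->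
  mod_dim (quot_module (quot_ideal J (fgen V))) = ebar (d - #|` V|).
Proof.
move=> VU JV; rewrite /mod_dim Supp_quot; apply: chain_sup_max => [|k].
  by apply/chain_quot => //; apply: chain_above_exists.
by move=> /(chain_quot _ JV)/(chain_above_le VU); lia.
Qed.

Lemma quot_surj (p : ideal R) z : exists x, quot_pi p (pi x) = z.
Proof.
have [y <-] := quot_pi_surj z; have [x <-] := ring_pi_surj y.
by exists x.
Qed.

Lemma nonvanishing_quot V W s0 : (V `<=` U)%fset -> (W `<=` U)%fset ->
  [disjoint V & W]%fset -> J `<=` fgen W -> {subset s0 <= W} ->
  nonvanishing (ideal_gen [set` [seq pi a | a <- V ++ s0]])
    (quot_module (quot_ideal J (fgen W))) = [set #|` V|].
Proof.
move=> VU WU VW JW s0W; set p := quot_ideal J (fgen W).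
pose f x := quot_pi p (pi x).
have fB : {morph f : x y / x - y} by move=> x y; rewrite /f ring_piB raddfB.
have fM a x : f (a * x) = pi a *: f x by rewrite quot_scale_pi -[pi a * _]ring_piM.
have fW x : zero_submod (quot_module p) (f x) <-> fgen W x.
  by rewrite -(quot_idealE _ JW) -quot_pi_eq0.
have notW x : x \in V -> x \notin W by apply/fdisjointP.
have regV t : perm_eq t V -> regseq (fgen W) t.
  move=> tV; apply: regseq_fgen => //.
  - by rewrite (perm_uniq tV) fset_uniq.
  - by move=> x; rewrite (perm_mem tV) => Vx; apply: (fsubsetP VU).
  - by move=> x; rewrite (perm_mem tV) => /notW.
rewrite map_cat -[#|` V|](size_map pi V).
apply: (@nonvanishing_regular _ (noetherian_quot (J := J) noethS) _ _ _ _ (f 1)).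
- move=> a m /mapP[b /s0W Wb ->]; have [x <-] := @quot_surj p m.
  by rewrite -fM; apply/fW/ideal_mulr/fgen_mem.
(* A permutation of the images is lifted to a permutation of [V] through positions. *)
- move=> t /(perm_iotaP 0)[is0 is_iota ->].
  have -> : [seq nth 0 [seq pi a | a <- V] i | i <- is0] = [seq pi a | a <- [seq nth 0 V i | i <- is0]].
    rewrite -map_comp; apply/eq_in_map => i;
      rewrite (perm_mem is_iota) mem_iota /= size_map => iV.
    by rewrite (nth_map 0).
  apply: (transfer_regseq fB fM (@quot_surj p) fW); apply: regV.
  by apply/(perm_iotaP 0); exists is0; rewrite ?size_map // in is_iota *.
move/(transfer_adjoins fB fM (@quot_surj p) _ fW).
have UVW : (V `|` W `<=` U)%fset by rewrite fsubUset VU.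
move=> VW1; apply: (primeU UVW).1; move: VW1; apply: adjoins_ideal_le => [|a Va].
  exact/fgenS/fsubsetUr.
by apply: fgen_mem; rewrite inE Va.
Qed.

Lemma ring_pi_prod s : \prod_(a <- [seq pi a | a <- s]) a = pi (\prod_(a <- s) a).
Proof. by rewrite big_map; elim: s => [|a s IHs];
  rewrite ?big_nil // !big_cons IHs -[LHS]ring_piM. Qed.

Lemma ideal_prod (K : ideal S) s a : a \in s -> K a -> K (\prod_(b <- s) b).
Proof.
move=> sa Ka; elim: s sa => // b s IHs; rewrite inE big_cons => /predU1P[<-|/IHs].
  exact: ideal_mulr.
exact: ideal_mull.
Qed.

Lemma ann_top_quot V W : (V `<=` U)%fset -> (W `<=` U)%fset ->
  [disjoint V & W]%fset -> J `<=` fgen W ->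
  (forall z, fgen W z -> J (\prod_(a <- V) a * z)) ->
  ann (local_cohomology (ideal_gen [set` [seq pi a | a <- V]]) #|` V| (R^o : lmodType R)) =
    quot_ideal J (fgen W).
Proof.
move=> VU WU VW JW WJ; apply: submodP => r; have [z <-] := ring_pi_surj r.
have fM a x : pi (a * x) = pi a *: (pi x : R^o) by exact: ring_piM.
have f0 x : zero_submod (R^o : lmodType R) (pi x) <-> J x.
  by rewrite -[x in J x]subr0 -ring_piE ring_pi0.
have tr n x : adjoins (zero_submod (R^o :
  lmodType R)) [seq a ^+ n | a <- [seq pi a | a <- V]] (pi x) <->
    adjoins J [seq a ^+ n | a <- V] x.
  have -> : [seq a ^+ n | a <- [seq pi a | a <- V]] = [seq pi a | a <- [seq a ^+ n | a <- V]].
    by rewrite -!map_comp; apply: eq_map => a /=; rewrite ring_piX.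
  exact: (transfer_adjoins (N := R^o) ring_piB fM (@ring_pi_surj _ J) _ f0).
rewrite (quot_idealE z JW) -(size_map pi V).
rewrite (ann_top_local_cohomology (noetherian_quot (J := J) noethS)).
have notW x : x \in V -> x \notin W by apply/fdisjointP.
split=> [annz|Wz n m]; last first.
  exists 1%N; have [x <-] := ring_pi_surj m.
  rewrite ring_pi_prod -ring_piX -(fM z x) -fM; apply/tr/sub_adjoins.
  by rewrite expr1 mulrA; apply: ideal_mulr; apply: WJ.
apply: (krull_intersection (s := V) noethS (primeU WU)).
  have UVW : (V `|` W `<=` U)%fset by rewrite fsubUset VU.
  move=> VW1; apply: (primeU UVW).1; move: VW1; apply: adjoins_ideal_le => [|a Va].
    exact/fgenS/fsubsetUr.
  by apply: fgen_mem; rewrite inE Va.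
move=> n; have [k] := annz n.+1 (pi 1).
rewrite ring_pi_prod -ring_piX -(fM z 1) -fM => /tr.
(* J is enlarged to (W), modulo which V is regular in any order, so the power of the product
   cancels. *)
move=> /(adjoinsS JW); rewrite mulr1 => zV.
apply: (@regseq_prodX S S^o (fgen W) V k) zV => t tV; apply: regseq_fgen => //.
- by rewrite (perm_uniq tV) fset_uniq.
- by move=> x; rewrite (perm_mem tV) => Vx; apply: (fsubsetP VU).
- by move=> x; rewrite (perm_mem tV) => /notW.
Qed.

Lemma quot_ideal_gen (A : ideal S) s : (forall a, a \in s -> A a) ->
  A `<=` adjoins J s -> quot_ideal J A = ideal_gen [set` [seq pi a | a <- s]].
Proof.
move=> sA As; apply: submodP => z; split.
  move=> [x /As Jx <-]; suff /(_ x Jx) : adjoins J s `<=`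
    pullback (ideal_gen [set` [seq pi a | a <- s]]) by [].
  apply: adjoins_ideal_le => [|a sa]; first exact: sub_pullback.
  by apply: sub_ideal_gen; apply: map_f.
by move: z; apply: ideal_gen_le => _ /= /mapP[a /sA Aa ->]; exists a.
Qed.

End Quotient.
End PrimeGenerators.

(** * The counterexample *)

Lemma ebarB m n : (n <= m)%N -> (ebar m - ebar n)%E = ebar (m - n).
Proof. by move=> nm; rewrite /ebar -EFinB subzn. Qed.

Lemma subnB2l k m n : (n <= m)%N -> (m - k - (m - n) = n - k)%N.
Proof. by lia. Qed.

Section ThreePrimes.
Variables (S : comPzRingType) (d : nat) (U : {fset S}).
Hypotheses (noethS : noetherian S) (dimS : ring_dim S = ebar d).
Hypotheses (heightU : height (fgen U) = ebar d) (cardU : (#|` U| <= d)%N).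
Hypothesis primeU : forall V, (V `<=` U)%fset -> prime_ideal (fgen V).
Variables (X Y Z : {fset S}).
Hypotheses (XU : (X `<=` U)%fset) (YU : (Y `<=` U)%fset) (ZU : (Z `<=` U)%fset).
Hypotheses (X0 : X != fset0) (Y0 : Y != fset0) (Z0 : Z != fset0).
Hypotheses (XY : [disjoint X & Y]%fset) (XZ : [disjoint X & Z]%fset).
Hypothesis YZ : [disjoint Y & Z]%fset.

Let J : ideal S := submod_cap (submod_cap (fgen X) (fgen Y)) (fgen Z).
Local Notation R := (quot_ring J).
Local Notation pi := (ring_pi J).

Lemma three_primes_sub : [/\ J `<=` fgen X, J `<=` fgen Y & J `<=` fgen Z].
Proof. by split=> x [[]]. Qed.

Let notin V W x : (V `<=` U)%fset -> (W `<=` U)%fset -> [disjoint V & W]%fset ->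
  x \in V -> ~ fgen W x.
Proof.
move=> VU WU /fdisjointP VW Vx.
exact: (fgen_notin noethS heightU cardU primeU WU (fsubsetP VU _ Vx) (VW _ Vx)).
Qed.

Let ring_pi_eq0 x : pi x = 0 <-> J x.
Proof. by rewrite -[x in J x]subr0 -ring_piE ring_pi0. Qed.

Let associated (A B C : {fset S}) : (forall x, J x <->
  [/\ fgen A x, fgen B x & fgen C x]) ->
  (A `<=` U)%fset -> (B `<=` U)%fset -> (C `<=` U)%fset -> B != fset0 -> C != fset0 ->
  [disjoint B & A]%fset -> [disjoint C & A]%fset ->
  Ass (R^o : lmodType R) (quot_ideal J (fgen A)).
Proof.
move=> JE AU BU CU /fset0Pn[b Bb] /fset0Pn[c Cc] BA CA.
have JA : J `<=` fgen A by move=> x /JE[].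
split; first exact/(prime_quot_ideal JA)/primeU.
(* The product b c lies in (B) and (C) but not in (A), so multiplying it into J takes exactly an
   element of (A). *)
exists (pi (b * c)); apply: submodP => r; have [a <-] := ring_pi_surj r.
rewrite (quot_idealE _ JA).
have -> : ann_elt (pi (b * c) : R^o) (pi a) <-> J (a * (b * c)).
  by rewrite -ring_pi_eq0 (ring_piM J a (b * c)).
rewrite JE; split=> [Aa|[+ _ _]].
  split; first exact: ideal_mulr.
    by apply/ideal_mull/ideal_mulr/fgen_mem.
  by apply/ideal_mull/ideal_mull/fgen_mem.
by case/(primeU AU).2 => // /(primeU AU).2[/(notin BU AU BA Bb)|/(notin CU AU CA Cc)].
Qed.

Lemma Ass_three_primes : Ass (R^o : lmodType R) =
  [set quot_ideal J (fgen X); quot_ideal J (fgen Y); quot_ideal J (fgen Z)].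
Proof.
have [JX JY JZ] := three_primes_sub.
apply/seteqP; split=> P; last first.
  case=> [[->|->]|->].
  - by apply: (@associated X Y Z) => //; [move=> x;
    split=> [[[]]|[]]|rewrite fdisjoint_sym|rewrite fdisjoint_sym].
  - by apply: (@associated Y X Z) => //; [move=> x;
    split=> [[[]]|[]]|rewrite fdisjoint_sym].
  - by apply: (@associated Z X Y) => //; move=> x; split=> [[[]]|[]].
move=> [[P1 PM] [x PE]]; have [w wE] := ring_pi_surj x.
have PJ a : P (pi a) <-> J (a * w).
  by rewrite PE -ring_pi_eq0 -wE (ring_piM J a w).
(* If P is none of the three primes, each (V) has a multiplier outside P sending w into it; their
   product sends w into J, so it lies in P, contradicting primality. *)
have alt V : (V `<=` U)%fset -> J `<=` fgen V ->
    P = quot_ideal J (fgen V) \/ exists2 a, ~ P (pi a) & fgen V (a * w).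
  move=> VU JV; case: (pselect (fgen V w)) => Vw; first by right; exists 1; rewrite ?mul1r.
  case: (pselect (exists2 a, fgen V a & ~ P (pi a))) => [[a Va Pa]|nVP].
    by right; exists a => //; apply: ideal_mulr.
  left; apply: submodP => r; have [a <-] := ring_pi_surj r.
  rewrite (quot_idealE _ JV); split=> [/PJ/JV|Va]; first by case/(primeU VU).2.
  by apply: contrapT => Pa; apply: nVP; exists a.
case: (alt X XU JX) => [->|[a Pa Xa]]; first by left; left.
case: (alt Y YU JY) => [->|[b Pb Yb]]; first by left; right.
case: (alt Z ZU JZ) => [->|[c Pc Zc]]; first by right.
have /PJ : J (a * b * c * w).
  split; [split|].
  - have -> : a * b * c * w = b * c * (a * w) by ring.
    exact: ideal_mull.
  - have -> : a * b * c * w = a * c * (b * w) by ring.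
    exact: ideal_mull.
  - have -> : a * b * c * w = a * b * (c * w) by ring.
    exact: ideal_mull.
by rewrite !ring_piM => /PM[/PM[]|].
Qed.

(** The bottom prime of a chain contains J, hence one of (X), (Y), (Z); the fewest generators allow
    the longest chain. *)
Lemma mod_dim_three_primes : (#|` X| <= #|` Y|)%N -> (#|` Y| <= #|` Z|)%N ->
  mod_dim (R^o : lmodType R) = ebar (d - #|` X|).
Proof.
move=> cXY cYZ; have [JX _ _] := three_primes_sub.
rewrite /mod_dim Supp_regular; apply: chain_sup_max => [|k].
  have /(chain_quot _ JX)[P [PX Pstrict]] :=
    chain_above_exists noethS heightU cardU primeU XU.
  by exists P; split=> // i /PX[].
move=> [Q [primeQ Qstrict]].
have primeP i : (i <= k)%N -> prime_ideal (pullback (Q i)) by move=> /primeQ;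
  apply: prime_pullback.
have Pstrict i : (i < k)%N -> pullback (Q i) `<` pullback (Q i.+1).
  by move=> /Qstrict; apply: pullback_proper.
have bound V : (V `<=` U)%fset -> (#|` X| <= #|` V|)%N -> fgen V `<=` pullback (Q 0) ->
  (k <= d - #|` X|)%N.
  move=> VU cXV VQ.
  suff : chain_in (above V) k by move=> /(chain_above_le noethS dimS heightU cardU primeU VU); lia.
  exists (fun i => pullback (Q i)); split=> // i ile; split; first exact: primeP.
  apply: subset_trans VQ _; apply: (@prime_chain_le _ (fun i => pullback (Q i)) k) => //.
case: (pselect (fgen X `<=` pullback (Q 0))) => [|XQ]; first exact: bound.
case: (pselect (fgen Y `<=` pullback (Q 0))) => [|YQ]; first exact: bound.
apply: (bound Z) => //; first exact: leq_trans cXY cYZ.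
move=> z Zz; apply: contrapT => Qz.
move/existsNP: XQ => [x /not_implyP[Xx Qx]]; move/existsNP: YQ => [y /not_implyP[Yy Qy]].
have /(@sub_pullback _ _ (Q 0)) : J (x * y * z).
  split; [split|];
    [exact/ideal_mulr/ideal_mulr|exact/ideal_mulr/ideal_mull|exact: ideal_mull].
by case/(primeP 0 isT).2 => // /(primeP 0 isT).2[].
Qed.

Section Generators.
Variables X' Y' : {fset S}.
Hypotheses (X'X : (X' `<=` X)%fset) (Y'Y : (Y' `<=` Y)%fset).
Hypotheses (X'0 : X' != fset0) (Y'0 : Y' != fset0).

Let I : ideal R := quot_ideal J (submod_add (submod_add (fgen X') (fgen Y')) J).

Lemma quot_ideal_two s : (forall x, (x \in s) = (x \in X') || (x \in Y')) ->
  I = ideal_gen [set` [seq pi a | a <- s]].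
Proof.
move=> sE; apply: quot_ideal_gen => [a|_ [_ [x X'x [y Y'y <-]] [z Jz <-]]].
  rewrite sE => /orP[] /fgen_mem ma; exists a; try (exists 0;
    [exact: submod0|exact: addr0]).
    by exists a => //; exists 0; [apply: submod0|apply: addr0].
  by exists 0; [apply: submod0|exists a => //; apply: add0r].
apply: submodD; [apply: submodD|exact: sub_adjoins].
  by move: x X'x; apply: fgen_le => x X'x; apply: adjoins_mem; rewrite sE X'x.
by move: y Y'y; apply: fgen_le => y Y'y; apply: adjoins_mem; rewrite sE Y'y orbT.
Qed.

(** Each prime misses an element of X' or Y': (Y) and (Z) miss x, (X) misses y. So w lies in all
    three. *)
Lemma Gamma_three_primes : Gamma I (R^o : lmodType R) = zero_submod (R^o : lmodType R).
Proof.
have /fset0Pn[x X'x] := X'0; have /fset0Pn[y Y'y] := Y'0.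
have Xx := fsubsetP X'X _ X'x; have Yy := fsubsetP Y'Y _ Y'y.
apply: submodP => r; have [w <-] := ring_pi_surj r; split; last first.
  by move=> ->; apply: submod0.
rewrite (@quot_ideal_two (X' ++ Y')) => [/Gamma_torsion tw|a]; last exact: mem_cat.
have kill a : a \in X' ++ Y' -> exists n, J (a ^+ n * w).
  move=> sa; have [n an] := tw _ (map_f pi sa); exists n.
  by apply/ring_pi_eq0; rewrite ring_piM ring_piX.
have primeVw V a n : (V `<=` U)%fset -> ~ fgen V a -> fgen V (a ^+ n * w) -> fgen V w.
  by move=> VU Va /(primeU VU).2[/(prime_idealX (primeU VU))|].
apply/ring_pi_eq0.
have [m [[_ Yxw] Zxw]] : exists m, J (x ^+ m * w) by apply: kill; rewrite mem_cat X'x.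
have [n [[Xyw _] _]] : exists n, J (y ^+ n * w) by apply: kill; rewrite mem_cat Y'y orbT.
split; [split|].
- by apply: (primeVw X y n) Xyw => //; apply: (notin YU) Yy => //; rewrite fdisjoint_sym.
- by apply: (primeVw Y x m) Yxw => //; apply: (notin XU) Xx.
- by apply: (primeVw Z x m) Zxw => //; apply: (notin XU) Xx.
Qed.

End Generators.
End ThreePrimes.

Theorem mainTheorem5 (S : comPzRingType) (d : nat) (u : 'I_d -> S)
    (X Y Z X' Y' : {fset S}) :
  let U : {fset S} := [fset u i | i in 'I_d]%fset in
  let gen (V : {fset S}) : ideal S := ideal_gen [set` V] in
  (3 <= d)%N -> noetherian S -> ring_dim S = ebar d ->
  height (gen U) = ebar d ->
  (forall V : {fset S}, (V `<=` U)%fset -> prime_ideal (gen V)) ->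
  (X `<=` U)%fset -> (Y `<=` U)%fset -> (Z `<=` U)%fset ->
  X != fset0 -> Y != fset0 -> Z != fset0 ->
  [disjoint X & Y]%fset -> [disjoint X & Z]%fset -> [disjoint Y & Z]%fset ->
  (#|` X| <= #|` Y| <= #|` Z|)%N ->
  (X' `<=` X)%fset -> (Y' `<=` Y)%fset -> X' != fset0 -> Y' != fset0 ->
  let J : ideal S := submod_cap (submod_cap (gen X) (gen Y)) (gen Z) in
  let R : comPzRingType := quot_ring J in
  let RR : lmodType R := R^o in
  let I : ideal R :=
    quot_ideal J (submod_add (submod_add (gen X') (gen Y')) J) in
  let p1 : ideal R := quot_ideal J (gen X) in
  let p2 : ideal R := quot_ideal J (gen Y) in
  let p3 : ideal R := quot_ideal J (gen Z) in
  let q : ideal R := quot_ideal J (gen (U `\` (X' `|` Y'))%fset) in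
  let c : nat := (#|` X'| + #|` Y'|)%N in
  (* (i) *)
  Ass RR = [set p1; p2; p3] /\
  (* (ii) *)
  [/\ depth I (quot_module p1) = ebar #|` Y'| /\
      cd I (quot_module p1) = ebar #|` Y'|,
      depth I (quot_module p2) = ebar #|` X'| /\
      cd I (quot_module p2) = ebar #|` X'|
    & depth I (quot_module p3) = ebar (#|` X'| + #|` Y'|) /\
      cd I (quot_module p3) = ebar (#|` X'| + #|` Y'|)] /\
  (* (iii) *)
  [/\ mod_dim (quot_module p1) = (ebar d - ebar #|` X|)%E,
      mod_dim (quot_module p2) = (ebar d - ebar #|` Y|)%E
    & mod_dim (quot_module p3) = (ebar d - ebar #|` Z|)%E] /\
  (* (iv) *)
  [/\ Gamma I RR = zero_submod RR,
      mod_dim RR = (ebar d - ebar #|` X|)%E,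
      mod_dim (quot_module (Gamma I RR)) = (ebar d - ebar #|` X|)%E
    & cd I RR = ebar c] /\
  (* (v) *)
  [/\ p3 `<=` q, cd I (quot_module q) = ebar c
    & mod_dim (quot_module q) = ebar c] /\
  (* (vi) *)
  [/\ ann (local_cohomology I c RR) = p3,
      mod_dim (quot_module (ann (local_cohomology I c RR))) =
        (ebar d - ebar #|` Z|)%E
    & (mod_dim (quot_module (Gamma I RR)) -
       mod_dim (quot_module (ann (local_cohomology I c RR))))%E =
        (ebar #|` Z| - ebar #|` X|)%E].

Proof.
move=> U gen d3 noethS dimS heightU primeU XU YU ZU X0 Y0 Z0 XY XZ YZ.
move=> /andP[cXY cYZ] X'X Y'Y X'0 Y'0 J R RR I p1 p2 p3 q c.
have cardU : (#|` U| <= d)%N.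
  apply: leq_trans (leq_imfset_card _ _ _) _.
  by rewrite -(card_uniqP (enum_finmem_uniq _)) -[X in (_ <= X)%N]card_ord max_card.
have cU := card_prime_generators noethS heightU cardU primeU.
have [JX JY JZ] := three_primes_sub X Y Z.
pose V := (X' `|` Y')%fset.
have X'U := fsubset_trans X'X XU; have Y'U := fsubset_trans Y'Y YU.
have VU : (V `<=` U)%fset by rewrite fsubUset X'U.
have cV : #|` V| = c.
  have X'Y' : [disjoint X' & Y']%fset by apply: fdisjointWl X'X _; apply: fdisjointWr Y'Y _.
  by rewrite cardfsU (eqP X'Y') cardfs0 subn0.
have le_d W : (W `<=` U)%fset -> (#|` W| <= d)%N by move=> /fsubset_leq_card; rewrite cU.
have dimW W : (W `<=` U)%fset -> J `<=` fgen W ->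
    mod_dim (quot_module (quot_ideal J (fgen W))) = (ebar d - ebar #|` W|)%E.
  move=> WU JW; rewrite ebarB ?le_d //.
  exact: (mod_dim_quot noethS dimS heightU cardU primeU WU JW).
have nv A W (s0 : seq S) : (A `<=` U)%fset -> (W `<=` U)%fset ->
  [disjoint A & W]%fset -> J `<=` fgen W ->
    {subset s0 <= W} -> (forall x, (x \in A ++ s0) = (x \in X') || (x \in Y')) ->
    nonvanishing I (quot_module (quot_ideal J (fgen W))) = [set #|` A|].
  move=> AU WU AW JW s0W As0; rewrite /I (quot_ideal_two X Y Z As0).
  exact: (nonvanishing_quot noethS heightU cardU primeU AU WU AW JW s0W).
have IV : I = ideal_gen [set` [seq ring_pi J a | a <- V]].
  by apply: quot_ideal_two => x; rewrite inE.
have VZ : [disjoint V & Z]%fset.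
  by rewrite fdisjointUX (fdisjointWl X'X XZ) (fdisjointWl Y'Y YZ).
(* W generates the preimage of q; as V and W partition U, all of V stays regular modulo (W). *)
pose W := (U `\` V)%fset.
have WU : (W `<=` U)%fset by apply: fsubsetDl.
have ZW : (Z `<=` W)%fset by rewrite fsubsetD ZU fdisjoint_sym.
have JW : J `<=` fgen W by apply: subset_trans JZ (fgenS ZW).
have VW : [disjoint V & W]%fset by rewrite fdisjoint_sym; apply/fdisjointP => x;
  rewrite inE => /andP[].
have annE : ann (local_cohomology I c RR) = p3.
  rewrite IV -cV; apply: (ann_top_quot noethS heightU cardU primeU VU ZU VZ JZ) => z Zz.
  have /fset0Pn[x X'x] := X'0; have /fset0Pn[y Y'y] := Y'0.
  split; last exact: ideal_mull.
  split; apply/ideal_mulr.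
    apply: (@ideal_prod _ _ _ x); first by rewrite inE X'x.
    exact/fgen_mem/(fsubsetP X'X).
  apply: (@ideal_prod _ _ _ y); first by rewrite inE Y'y orbT.
  exact/fgen_mem/(fsubsetP Y'Y).
have primep3 : prime_ideal p3 by apply: prime_quot_ideal JZ (primeU _ ZU).
have GammaE : Gamma I RR = zero_submod RR.
  exact: (Gamma_three_primes noethS heightU cardU primeU).
have dimRR : mod_dim RR = (ebar d - ebar #|` X|)%E.
  by rewrite ebarB ?le_d //; apply: (mod_dim_three_primes noethS dimS heightU cardU primeU).
(* The upper bound counts generators; nonvanishing in degree c holds since 1 is not in p3. *)
have cdR : cd I RR = ebar c.
  apply: cd_max => [|i].
    apply: contrapT => nx; apply: primep3.1; rewrite -annE => x.
    by rewrite scale1r; apply: contrapT => x0; apply: nx; exists x.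
  have := @nonvanishing_le _ (noetherian_quot (J :=
    J) noethS) RR [seq ring_pi J a | a <- V] [::].
  by rewrite cats0 size_map IV -cV; apply.
have nv3 : nonvanishing I (quot_module p3) = [set c].
  by rewrite -cV; apply: (nv V Z [::]) => // x; rewrite cats0 inE.
have dimG : mod_dim (quot_module (Gamma I RR)) = (ebar d - ebar #|` X|)%E.
  rewrite GammaE -dimRR /mod_dim Supp_quot Supp_regular; congr chain_sup.
  apply/seteqP; split=> [P []//|P primeP]; split=> // x ->; exact: submod0.
have dim3 : mod_dim (quot_module p3) = (ebar d - ebar #|` Z|)%E by apply: dimW.
split; first exact: (Ass_three_primes noethS heightU cardU primeU).
split.
  have nv1 : nonvanishing I (quot_module p1) = [set #|` Y'|].
    apply: (nv Y' X X') => //; last by move=> x; rewrite mem_cat orbC.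
      by apply: fdisjointWl Y'Y _; rewrite fdisjoint_sym.
    exact/fsubsetP.
  have nv2 : nonvanishing I (quot_module p2) = [set #|` X'|].
    apply: (nv X' Y Y') => //; last by move=> x; rewrite mem_cat.
      exact: fdisjointWl X'X _.
    exact/fsubsetP.
  split; first by split; [exact: depth_set1 nv1|exact: cd_set1 nv1].
    by split; [exact: depth_set1 nv2|exact: cd_set1 nv2].
  by split; [exact: depth_set1 nv3|exact: cd_set1 nv3].
split; first by split; [exact: dimW XU JX|exact: dimW YU JY|exact: dim3].
split; first by split; [exact: GammaE|exact: dimRR|exact: dimG|exact: cdR].
split.
  split; first exact/(quot_ideal_le _ JW)/fgenS.
    apply: cd_set1; rewrite -cV; apply: (nv V W [::]) => // x; by rewrite cats0 inE.
  rewrite [LHS](dimW W WU JW) ebarB ?le_d // cardfsDS // cV cU.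
  by rewrite subKn // -cV le_d.
rewrite annE dimG dim3; split=> //.
have cXZ := leq_trans cXY cYZ.
rewrite !ebarB ?le_d //; last by apply: leq_sub2l.
by rewrite (subnB2l _ (le_d Z ZU)).
Qed.
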